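(* Let $a,b,c,d,f,g,h,\ell,p,r,s,t,u,w\in\mathbb R$ with $pr\ge 0$ and suppose that $$c=-d\quad\text{or}\quad h=-\ell\quad\text{or}\quad (c>-d\text{ and }h>-\ell)\quad\text{or}\quad(c<-d\text{ and }h<-\ell).$$ Then the sequence $(m_n)_{n\ge0}$, where $m_n$ is the coefficient of $z^n$ in $\mathcal C(z)$, is the moment sequence of some probability measure on the real line, i.e. there is a Borel probability measure $\mu$ on $\mathbb R$ with $\int_{\mathbb R}x^n\,d\mu(x)=m_n$ for all $n\ge0$. If $p=0$ or $r=0$, the measure is unique and consists of one atom. If $pr>0$ and ($c=-d$ or $h=-\ell$), the measure is unique and is formed of two atoms. More generally, when $\max(|c|,|d|)\cdot\max(|h|,|\ell|)\le1$, the measure is unique.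
   Context: For $n\ge1$, $[n]_{x,y}:=\sum_{i=0}^{n-1}x^{n-1-i}y^{i}$, and $[0]_{x,y}:=0$, with the convention $0^0=1$. For real parameters $a,b,c,d,f,g,h,\ell,p,r,s,t,u,w$, $\mathcal C(z)$ is the formal power series in $z$ defined by the continued fraction $$\mathcal C(z)=\cfrac{1}{1-\alpha_0z-\cfrac{\beta_1z^2}{1-\alpha_1z-\cfrac{\beta_2z^2}{\ddots}}},\qquad \alpha_n=u\,w^n+s\,[n]_{a,b}+t\,[n]_{f,g}\ (n\ge 0),\quad \beta_n=p\,r\,[n]_{c,d}\,[n]_{h,\ell}\ (n\ge 1).$$ In particular $m_0=1$. *)

(* Defs.v *)
From HB Require Import structures.
From mathcomp Require Import all_boot all_order all_algebra.
From mathcomp Require Import all_classical all_reals all_analysis.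
Import Order.TTheory GRing.Theory Num.Theory.
Import numFieldNormedType.Exports.

Set Implicit Arguments.
Unset Strict Implicit.
Unset Printing Implicit Defensive.

Local Open Scope classical_set_scope.
Local Open Scope ring_scope.

(* [x ^+ 0 = 1] for every x, so the convention 0^0 = 1 is built in. *)
Definition xybracket (R : nzRingType) (n : nat) (x y : R) : R :=
  \sum_(i < n) x ^+ (n.-1 - i) * y ^+ i.

(* Formal power series as coefficient sequences. *)
Section FormalPowerSeries.
Context (R : fieldType).

Definition fps : Type := nat -> R.

Definition fps_one : fps := fun n => (n == 0%N)%:R.

Definition fps_mul (f g : fps) : fps :=
  fun n => \sum_(i < n.+1) f i * g (n - i)%N.

Fixpoint fps_inv_coefs (f : fps) (n : nat) : seq R :=
  if n is m.+1 then
    let s := fps_inv_coefs f m in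
    rcons s (- (f 0%N)^-1 * \sum_(i < n) f i.+1 * s`_(m - i))
  else [:: (f 0%N)^-1].

(* The multiplicative inverse when [f 0 != 0], see [fps_mul_inv]. *)
Definition fps_inv (f : fps) : fps := fun n => (fps_inv_coefs f n)`_n.

Lemma size_fps_inv_coefs f n : size (fps_inv_coefs f n) = n.+1.
Proof. by elim: n => //= n IHn; rewrite size_rcons IHn. Qed.

Lemma nth_fps_inv_coefs f n i : (i <= n)%N ->
  (fps_inv_coefs f n)`_i = fps_inv f i.
Proof.
elim: n => [|n IHn]; first by rewrite leqn0 => /eqP ->.
rewrite leq_eqVlt => /orP[/eqP -> //|lt_in].
by rewrite /= nth_rcons size_fps_inv_coefs lt_in IHn.
Qed.

Lemma fps_inv0 f : fps_inv f 0 = (f 0%N)^-1.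
Proof. by []. Qed.

Lemma fps_invS f n :
  fps_inv f n.+1 =
    - (f 0%N)^-1 * \sum_(i < n.+1) f i.+1 * fps_inv f (n - i)%N.
Proof.
rewrite /fps_inv /= nth_rcons size_fps_inv_coefs ltnn eqxx.
congr (_ * _); apply: eq_bigr => i _.
by rewrite nth_fps_inv_coefs // leq_subr.
Qed.

Lemma fps_mul_inv f : f 0%N != 0 -> fps_mul f (fps_inv f) =1 fps_one.
Proof.
move=> f0 [|n]; rewrite /fps_mul /fps_one.
  by rewrite big_ord_recl big_ord0 addr0 subn0 fps_inv0 mulfV.
rewrite big_ord_recl subn0 fps_invS mulrA mulrN mulfV // mulN1r.
by under [X in _ + X]eq_bigr => i _ do rewrite subSS; rewrite addNr.
Qed.

Lemma eq_fps_inv f f' n : (forall i, (i <= n)%N -> f i = f' i) ->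
  forall i, (i <= n)%N -> fps_inv f i = fps_inv f' i.
Proof.
move=> eqf; elim/ltn_ind => -[|i] IHi le_in; first by rewrite !fps_inv0 eqf.
rewrite !fps_invS eqf //; congr (_ * _); apply: eq_bigr => j _.
have le_ji : (j <= i)%N by rewrite -ltnS.
rewrite eqf ?IHi // ?ltnS ?leq_subr //.
  by rewrite (leq_trans (leq_subr _ _)) // ltnW.
by rewrite (leq_trans _ le_in).
Qed.

(** Jacobi continued fractions
    1 / (1 - al_0 z - be_1 z^2 / (1 - al_1 z - be_2 z^2 / ...)). *)

(* The series 1 - A z - B z^2 F(z). *)
Definition jden (A B : R) (F : fps) : fps := fun n =>
  match n with 0 => 1 | 1 => - A | m.+2 => - (B * F m) end.

(* The finite fraction with coefficients al_k, be_(k+1), ..., al_(k+N),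
   where be_(k+N+1) has been replaced by 0. *)
Fixpoint jconvergent (al be : nat -> R) (N k : nat) : fps :=
  fps_inv (if N is N'.+1
           then jden (al k) (be k.+1) (jconvergent al be N' k.+1)
           else jden (al k) 0 fps_one).

(* The infinite fraction starting at level k: the coefficientwise limit of the
   convergents, the coefficient of z^n being stationary from N = n on
   ([jconvergent_stable]). *)
Definition jfraction_from (al be : nat -> R) (k : nat) : fps :=
  fun n => jconvergent al be n k n.

Definition jfraction (al be : nat -> R) : fps := jfraction_from al be 0.

Lemma jconvergent_stable al be n N k : (n <= N)%N ->
  jconvergent al be N k n = jfraction_from al be k n.
Proof.
suff eqNM : forall n N M k i, (n <= N)%N -> (n <= M)%N -> (i <= n)%N ->
    jconvergent al be N k i = jconvergent al be M k i.
  by move=> le_nN; apply: (eqNM n).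
move=> {n N k}; elim=> [|n IHn] N M k i le_nN le_nM le_in.
  by move: le_in; rewrite leqn0 => /eqP ->; case: N M {le_nN le_nM} => [|N] [|M].
case: N M le_nN le_nM => [|N] [|M] //; rewrite !ltnS => le_nN le_nM /=.
apply: (@eq_fps_inv _ _ n.+1) => // -[|[|j]] //= lt_jn.
by rewrite (IHn N M) // ltnW.
Qed.

Lemma jfraction_fromE al be k :
  fps_mul (jden (al k) (be k.+1) (jfraction_from al be k.+1))
          (jfraction_from al be k) =1 fps_one.
Proof.
set D := jden _ _ _.
suff invE : jfraction_from al be k =1 fps_inv D.
  move=> n; rewrite -(@fps_mul_inv D) ?oner_eq0 //.
  by apply: eq_bigr => i _; rewrite invE.
move=> n; rewrite -(@jconvergent_stable al be n n.+1) //=.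
apply: (@eq_fps_inv _ _ n) => // -[|[|j]] //= lt_jn.
by rewrite jconvergent_stable // ltnW // ltnW.
Qed.

End FormalPowerSeries.

Section Moments.
Context (R : realType).

Definition has_moments (mu : probability (measurableTypeR R) R)
    (m : nat -> R) : Prop :=
  forall n : nat,
    mu.-integrable [set: R] (fun x : R => (x ^+ n)%:E) /\
    (\int[mu]_(x in [set: R]) (x ^+ n)%:E)%E = (m n)%:E.

(* Agreement is only asked on measurable sets, since a measure is represented
   by a function on all sets. *)
Definition moment_determinate (m : nat -> R) : Prop :=
  forall mu nu : probability (measurableTypeR R) R,
    has_moments mu m -> has_moments nu m ->
    forall A : set (measurableTypeR R), measurable A -> mu A = nu A.

Definition formed_of_atoms (k : nat)
    (mu : probability (measurableTypeR R) R) : Prop :=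
  exists s : seq R,
    [/\ uniq s, size s = k,
        (forall x : R, x \in s -> (0 < mu [set x])%E)
      & mu [set` s] = 1%E].

End Moments.

Section Coefficients.
Context (R : realType).

Definition alpha (a b f g s t u w : R) (n : nat) : R :=
  u * w ^+ n + s * xybracket n a b + t * xybracket n f g.

Definition beta (c d h l p r : R) (n : nat) : R :=
  p * r * xybracket n c d * xybracket n h l.

End Coefficients.

(* Main.v *)
Require Import Defs.
From HB Require Import structures.
From mathcomp Require Import all_boot all_order all_algebra.
From mathcomp Require Import all_classical all_reals all_analysis.
From mathcomp Require Import measurable_realfun.
From mathcomp Require Import complex spectral sesquilinear.
From mathcomp Require Import ring lra zify.
Import Order.TTheory GRing.Theory Num.Theory.
Import numFieldNormedType.Exports.
Set Implicit Arguments.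
Unset Strict Implicit.
Unset Printing Implicit Defensive.
Local Open Scope classical_set_scope.
Local Open Scope ring_scope.

(* The moments are [m n = (J^n e_0)_0], where [J] is the Jacobi matrix with
   diagonal alpha and off-diagonal entries [sqrt beta].
   Existence: diagonalising the truncations of [J] gives discrete measures with
   the right first moments.  Along a subsequence their quantile functions
   converge outside a countable set (Helly), and Fatou's lemma, applied to
   nonnegative polynomials, identifies the moments of the limit.
   Uniqueness: if [beta 1 = 0] or [beta 2 = 0], a polynomial [P] of degree 1 or 2
   satisfies [L (P * P) = 0], and every solution lives on the roots of [P].
   Otherwise the bound on [c], [d], [h], [l] gives [sqrt (beta n) = O(n)], hence
   [sum_n 1 / sqrt (beta n) = +oo] (Carleman).  With [p_n] the orthonormal
   polynomials and [z = x0 + i], the Wronskian of [Re p_n(z)] and [Im p_n(z)]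
   then shows that [K_n = sum_(k < n) |p_k(z)|^2] is unbounded, so that
   [1 / (x - z)] is a limit of polynomials in [L^1], uniformly over all
   solutions.  This property passes to powers of [1/2 + Re (1 / (x - z))], from
   which one builds bounded functions tending to the indicator of [x < x0]. *)

(** * Moments of a Jacobi fraction *)

Section JacobiMoments.
Context (R : fieldType).
Implicit Types (f g h : fps R) (a b al be : nat -> R).

(** Coefficients below [N] only see truncations, so commutativity and associativity of [fps_mul] are
    inherited from polynomials. *)
Lemma fps_mulE N f g n : (n < N)%N ->
  fps_mul f g n = (\poly_(i < N) f i * \poly_(i < N) g i)`_n.
Proof.
move=> nN; rewrite coefM; apply: eq_bigr => i _.
have iN : (i < N)%N by apply: leq_ltn_trans nN; rewrite -ltnS.
by rewrite !coef_poly iN (leq_ltn_trans (leq_subr _ _) nN).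
Qed.

Lemma fps_mulC f g : fps_mul f g =1 fps_mul g f.
Proof. by move=> n; rewrite !(@fps_mulE n.+1) // mulrC. Qed.

Lemma eq_fps_mul f f' g g' : f =1 f' -> g =1 g' -> fps_mul f g =1 fps_mul f' g'.
Proof. by move=> ff' gg' n; apply: eq_bigr => i _; rewrite ff' gg'. Qed.

Lemma fps_mulA f g h : fps_mul f (fps_mul g h) =1 fps_mul (fps_mul f g) h.
Proof.
move=> n; pose T (f0 : fps R) := \poly_(i < n.+1) f0 i.
transitivity ((T f * (T g * T h))`_n).
  rewrite coefM; apply: eq_bigr => i _.
  by rewrite coef_poly ltn_ord -fps_mulE // ltnS leq_subr.
rewrite mulrA coefM; apply: eq_bigr => i _.
by rewrite -fps_mulE // coef_poly ltnS leq_subr.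
Qed.

Lemma fps_mulr1 f : fps_mul f (@fps_one R) =1 f.
Proof.
move=> n; rewrite /fps_mul big_ord_recr /= subnn /fps_one eqxx mulr1.
rewrite big1 ?add0r // => i _; rewrite subn_eq0 leqNgt ltn_ord.
by rewrite mulr0.
Qed.

Definition fps_shift f : fps R := fun n => if n is m.+1 then f m else 0.

Lemma fps_mul_shift f g : fps_mul (fps_shift f) g =1 fps_shift (fps_mul f g).
Proof.
case=> [|n]; first by rewrite /fps_mul big_ord_recl big_ord0 mul0r addr0.
by rewrite /fps_mul big_ord_recl mul0r add0r.
Qed.

Lemma fps_mul_jden f A B g n : fps_mul f (jden A B g) n =
  f n - A * fps_shift f n - B * fps_shift (fps_shift (fps_mul f g)) n.
Proof.
rewrite fps_mulC [LHS]/fps_mul; case: n => [|[|n]].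
- by rewrite big_ord_recl big_ord0 /= !mulr0 !subr0 addr0 mul1r.
- by rewrite !big_ord_recl big_ord0 /=; ring.
rewrite [fps_shift (fps_shift _) _]/= (fps_mulC f g n) /fps_mul mulr_sumr -sumrN.
rewrite big_ord_recl big_ord_recl /= subn0 subSS subn0 mul1r mulNr addrA.
by congr (_ + _); apply: eq_bigr => i _; rewrite /= mulNr mulrA.
Qed.

(* The vector J^n e_0, where J is the symmetric tridiagonal infinite matrix
   with diagonal a_0, a_1, ... and off-diagonal b_1, b_2, ... *)
Fixpoint jvec a b (n k : nat) : R :=
  if n is n'.+1 then
    (if k is k'.+1 then b k * jvec a b n' k' else 0) + a k * jvec a b n' k
    + b k.+1 * jvec a b n' k.+1
  else (k == 0%N)%:R.

(* z^k F_0 ... F_k, where F_k is the fraction starting at level k *)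
Fixpoint jprod al be (k : nat) : fps R :=
  if k is k'.+1 then fps_mul (fps_shift (jprod al be k')) (jfraction_from al be k)
  else jfraction_from al be 0.

(** With [F_k] the fraction starting at level [k], multiply [F_k (1 - al_k z - be_(k+1) z^2 F_(k+1))
    = 1] by [z^k F_0 ... F_(k-1)] and read off the coefficient of [z^(n+1)]. *)
Lemma jprodS al be k n :
  jprod al be k n.+1 =
    (if k is k'.+1 then jprod al be k' n else 0) + al k * jprod al be k n
    + be k.+1 * jprod al be k.+1 n.
Proof.
have -> : jprod al be k.+1 n =
    fps_shift (fps_mul (jprod al be k) (jfraction_from al be k.+1)) n.
  by rewrite -fps_mul_shift.
have /(_ n.+1) := fps_mul_jden (jprod al be k) (al k) (be k.+1)
  (jfraction_from al be k.+1).
set lhs := fps_mul _ _ _.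
suff -> : lhs = if k is k'.+1 then jprod al be k' n else 0.
  by rewrite [fps_shift (jprod _ _ _) _]/= [fps_shift _ n.+1]/= => ->; ring.
rewrite /lhs; case: k {lhs} => [|k]; first by rewrite fps_mulC jfraction_fromE.
rewrite -fps_mulA (@eq_fps_mul _ (fps_shift (jprod al be k)) _ (@fps_one R)) //.
  by rewrite fps_mulr1.
by move=> i; rewrite fps_mulC jfraction_fromE.
Qed.

Lemma jprod0 al be k : jprod al be k 0 = (k == 0%N)%:R.
Proof.
case: k => [|k]; last by rewrite [LHS]fps_mul_shift.
by rewrite /jprod /jfraction_from /= fps_inv0 /= invr1.
Qed.

(** Rescaling level [k] by [b_1 ... b_k] symmetrises the recurrence [jprodS]. Nothing is divided, so
    [b] may have zero entries. *)
Lemma jvec_jprod a b n k :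
  jvec a b n k = \prod_(i < k) b i.+1 * jprod a (fun i => b i ^+ 2) k n.
Proof.
elim: n k => [|n IHn] k.
  by rewrite jprod0 /=; case: k => [|k]; rewrite ?big_ord0 ?mulr1 ?mulr0.
rewrite jprodS /= !IHn big_ord_recr /=; case: k => [|k]; last first.
  by rewrite !IHn big_ord_recr /=; ring.
by rewrite !big_ord0; ring.
Qed.

Lemma jfraction_jvec a b be : (forall k, b k.+1 ^+ 2 = be k.+1) ->
  jfraction a be =1 (jvec a b)^~ 0%N.
Proof.
move=> bE n; rewrite jvec_jprod big_ord0 mul1r /= /jfraction /jfraction_from.
suff eqN N k : jconvergent a be N k = jconvergent a (fun i => b i ^+ 2) N k.
  by rewrite eqN.
by elim: N k => [|N IHN] k //=; rewrite IHN bE.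
Qed.

End JacobiMoments.

(** * Quadrature formulas from truncated Jacobi matrices *)

Lemma exp_conj_diag (F : comUnitRingType) N (P : 'M[F]_N.+1) (d : 'rV_N.+1) n :
  P \in unitmx -> (invmx P *m diag_mx d *m P) ^+ n =
    invmx P *m diag_mx (\row_i d 0 i ^+ n) *m P.
Proof.
move=> Pu; elim: n => [|n IHn].
  rewrite expr0 (_ : diag_mx _ = 1%:M) ?mulmx1 ?mulVmx //.
  by apply/matrixP => i j; rewrite !mxE expr0.
rewrite exprSr IHn -[LHS]/(_ *m _) !mulmxA mulmxK // -!mulmxA; congr (_ *m _).
rewrite !mulmxA; congr (_ *m _).
by apply/matrixP => i j; rewrite mul_diag_mx !mxE exprSr mulrnAr.
Qed.

Section Quadrature.
Context (R : rcfType).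
Implicit Types (a b : nat -> R).

Definition jmatrix a b N : 'M[R]_N.+1 :=
  \matrix_(i, j) (a i *+ (i == j :> nat) + b i *+ (i == j.+1 :> nat)
                  + b j *+ (j == i.+1 :> nat)).

Lemma jvec_support a b n k : (n < k)%N -> jvec a b n k = 0.
Proof.
elim: n k => [|n IHn] [|k] //= nk.
by rewrite !IHn ?mulr0 ?addr0 //; lia.
Qed.

(** Each application of [J] extends the support by one index, so up to the power [N] the truncation
    loses nothing. *)
Lemma jmatrix_jvec a b N n : (n <= N)%N ->
  delta_mx 0 0 *m jmatrix a b N ^+ n = \row_k jvec a b n k.
Proof.
elim: n => [|n IHn] nN.
  by rewrite expr0 mulmx1; apply/rowP => k; rewrite !mxE eqxx.
rewrite exprSr mulmxA IHn ?(ltnW nN) //; apply/rowP => k; rewrite !mxE /=.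
have sumE (F : nat -> R) m : (m < N.+1)%N || (F m == 0) ->
    \sum_(j < N.+1) F j *+ (j == m :> nat) = F m.
  move=> mN; under eq_bigr do rewrite mulrb.
  by rewrite -big_mkcond big_ord1_eq; case: ltnP mN => //= _ /eqP ->.
under eq_bigr => j _ do rewrite !mxE !mulrDr !mulrnAr.
rewrite !big_split /= (sumE (fun j => jvec a b n j * a j)) ?ltn_ord //.
rewrite (sumE (fun j => jvec a b n j * b j) k.+1); last first.
  case: ltnP => //= kN; rewrite jvec_support ?mul0r //.
  exact: leq_trans (leqW nN) kN.
case: k => -[|k] /= kN.
  by rewrite [X in _ + X]big1 ?addr0 //; ring.
under [X in _ + _ + X]eq_bigr => j _ do rewrite eqSS [_ == _ :> nat]eq_sym.
rewrite (sumE (fun j => jvec a b n j * b k.+1)) ?(ltnW kN) //.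
by ring.
Qed.

(** Writing the truncation as [P^-1 D P] with [P] unitary gives the nodes [D_i] and the weights
    [|P_(i,0)|^2], the moment being the [(0,0)] entry of the power. *)
Lemma quadrature a b N : exists (w x : 'I_N.+1 -> R),
  (forall i, 0 <= w i) /\
  forall n, (n <= N)%N -> jvec a b n 0 = \sum_i w i * x i ^+ n.
Proof.
pose A := map_mx (real_complex R) (jmatrix a b N).
have Aherm : A \is hermsymmx.
  apply: realsym_hermsym.
    apply/is_hermitianmxP; rewrite expr0 scale1r map_mx_id //.
    by apply/matrixP => i j; rewrite !mxE; congr (real_complex R _);
       rewrite eq_sym -addrA [X in _ + X]addrC addrA; case: eqP => [->|].
  by apply/mxOverP => i j; rewrite mxE complex_real.
have /orthomx_spectralP := hermitian_normalmx Aherm.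
set P := spectralmx A; set D := spectral_diag A => AE.
have Pu : P \is unitarymx by exact: spectral_unitarymx.
have Pinv : P \in unitmx by exact: spectral_unit.
have Dreal i : D 0 i \is Num.real.
  by have /mxOverP/(_ 0 i) := hermitian_spectral_diag_real Aherm.
have AnE n : A ^+ n = invmx P *m diag_mx (\row_i D 0 i ^+ n) *m P.
  by rewrite AE exp_conj_diag.
exists (fun i => complex.Re (`|P i 0| ^+ 2)), (fun i => complex.Re (D 0 i)); split.
  by move=> i; rewrite -ler0c RRe_real ?exprn_ge0 // realX // normr_real.
move=> n nN; apply: (@complexI R).
transitivity ((A ^+ n) 0 0).
  rewrite /A -rmorphXn /= mxE; congr (real_complex R _).
  have /rowP/(_ 0) := jmatrix_jvec a b nN.
  by rewrite -rowE !mxE => <-.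
rewrite AnE invmx_unitary // -mulmxA mxE rmorph_sum; apply: eq_bigr => i _.
rewrite mul_diag_mx !mxE rmorphM rmorphXn /= (RRe_real (Dreal i)).
rewrite (RRe_real (_ : `|P i 0| ^+ 2 \is Num.real)) ?realX ?normr_real //.
by rewrite normCK; ring.
Qed.
End Quadrature.

(** * The moment functional on polynomials *)

Section Functional.
Context (R : realFieldType).
Implicit Types (m : nat -> R) (p q : {poly R}).

Definition mfunct m p : R := \sum_(i < size p) p`_i * m i.

Lemma mfunctE m p N : (size p <= N)%N -> mfunct m p = \sum_(i < N) p`_i * m i.
Proof.
move=> pN; rewrite /mfunct (big_ord_widen N (fun i => p`_i * m i)) //.
rewrite big_mkcond; apply: eq_bigr => i _; case: ltnP => // le_pi.
by rewrite nth_default // mul0r.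
Qed.

Lemma mfunct_is_linear m : scalar (mfunct m).
Proof.
move=> k p q; pose N := maxn (size (k *: p + q)) (maxn (size p) (size q)).
rewrite !(@mfunctE m _ N) ?leq_max ?leqnn ?orbT //.
rewrite mulr_sumr -big_split /=; apply: eq_bigr => i _.
by rewrite coefD coefZ mulrDl mulrA.
Qed.

HB.instance Definition _ m := GRing.isLinear.Build R {poly R} R _ (mfunct m)
  (mfunct_is_linear m).

Lemma mfunctZ m c p : mfunct m (c *: p) = c * mfunct m p.
Proof. exact: linearZ. Qed.

Lemma mfunctXn m n : mfunct m 'X^n = m n.
Proof.
rewrite /mfunct size_polyXn big_ord_recr /= big1 => [|i _].
  by rewrite coefXn eqxx mul1r add0r.
by rewrite coefXn ltn_eqF ?mul0r.
Qed.

Lemma mfunctC m c : mfunct m c%:P = c * m 0%N.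
Proof. by rewrite -alg_polyC linearZ /= (mfunctXn m 0). Qed.

End Functional.

(** * Existence of a representing measure *)

Section Quantile.
Context (R : realType).
Implicit Types (A x u : R) (s : seq (R * R)).

(* The value at [u] of the quantile function of the measure with an atom of
   weight [e.2] at [e.1] for each [e] in [s], where [s] is sorted and cumulative
   weights are counted from [A]; [x] is a default value past the last atom. *)
Fixpoint quant A x s u : R :=
  if s is e :: s' then if u < A + e.2 then e.1 else quant (A + e.2) e.1 s' u
  else x.

Lemma quant_ge A x s u : path <=%R x (map fst s) -> x <= quant A x s u.
Proof.
elim: s A x => [|e s IHs] A x //= /andP[xe es].
by case: ifP => // _; exact: le_trans xe (IHs _ _ es).
Qed.

Lemma quant_homo A x s : path <=%R x (map fst s) -> nondecreasing_fun (quant A x s).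
Proof.
move=> + u v uv; elim: s A x => [|e s IHs] A x //= /andP[xe es].
case: ifPn => [uA|]; case: ifPn => // vA; first exact: quant_ge.
  by rewrite (le_lt_trans uv vA).
by move=> _; exact: IHs.
Qed.

Local Notation leb := (@lebesgue_measure R).

Lemma measurable_quant A x s D : path <=%R x (map fst s) -> measurable D ->
  measurable_fun D (quant A x s).
Proof. by move=> xs mD; apply: nondecreasing_measurable => //; exact: quant_homo. Qed.

(** The first atom occupies an interval whose length is its weight, on which [quant] is constant;
    the rest follows by induction. *)
Lemma integral_quant A x s (h : R -> R) : path <=%R x (map fst s) ->
  (forall e, e \in s -> 0 <= e.2) -> measurable_fun setT h -> (forall y, 0 <= h y) ->
  (\int[leb]_(u in `[A, (A + \sum_(e <- s) e.2)%R[) (h (quant A x s u))%:E =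
   (\sum_(e <- s) e.2 * h e.1)%R%:E)%E.
Proof.
move=> + + mh h0; elim: s A x => [|e s IHs] A x.
  by move=> _ _; rewrite !big_nil addr0 set_itvco0 integral_set0.
move=> /= es e0; have [xe {}es] := andP es.
have e2 : 0 <= e.2 by rewrite e0 ?mem_head.
have s2 : 0 <= \sum_(i <- s) i.2.
  by rewrite big_seq sumr_ge0 // => i si; rewrite e0 // inE si orbT.
rewrite !big_cons addrA.
rewrite (@itv_bndbnd_setU _ _ _ (BLeft (A + e.2))) ?bnd_simp ?lerDl //.
rewrite ge0_integral_setU //=; last 3 first.
- apply/measurable_EFinP; apply: (measurableT_comp mh).
  by apply: (@measurable_quant A x (e :: s)) => //=; rewrite ?xe //; exact: measurableU.
- by move=> u _; rewrite lee_fin.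
- apply/disj_setPS => u [] /=; rewrite !in_itv /= => /andP[_ uA] /andP[Au _].
  by move: (lt_le_trans uA Au); rewrite ltxx.
rewrite EFinD; congr (_ + _)%E.
  rewrite (@eq_integral _ _ _ _ _ (cst (h e.1)%:E)); last first.
    by move=> u; rewrite inE /= in_itv /= => /andP[_ ->].
  rewrite integral_cst //= lebesgue_measure_itv /= lte_fin ltrDl lt_neqAle e2 andbT.
  case: eqP => [<-|_] /=; first by rewrite mule0 mul0r.
  by rewrite -EFinD addrAC subrr add0r -EFinM mulrC.
rewrite -(IHs (A + e.2) e.1) //; last by move=> i si; rewrite e0 // inE si orbT.
apply: eq_integral => u; rewrite inE /= in_itv /= => /andP[Au _].
by rewrite ltNge Au.
Qed.

End Quantile.

(** * Helly selection for monotone functions *)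

Section Helly.
Context (R : realType).

Lemma increasing_seq_ge (f : nat -> nat) n : increasing_seq f -> (n <= f n)%N.
Proof.
move=> incf; elim: n => // n /leq_ltn_trans; apply.
by rewrite ltnNge -leEnat incf ltnn.
Qed.

Lemma diagonal_subsequence (v : nat -> nat -> R) :
  (forall i, exists M : R, forall n, `|v i n| <= M) ->
  exists2 phi : nat -> nat, (forall k, (k <= phi k)%N) &
    forall i, exists l : R, v i (phi k) @[k --> \oo] --> l.
Proof.
move=> vbnd.
have step (gi : (nat -> nat) * nat) : exists f : nat -> nat,
    increasing_seq f /\ cvgn (fun k => v gi.2 (gi.1 (f k))).
  case: gi => g i; have [M vM] := vbnd i.
  have [|f incf cvf] := @bolzano_weierstrass R (fun k => v i (g k)).
    exists M; split; first exact: num_real.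
    by move=> B MB n _ /=; apply: le_trans (vM _) (ltW MB).
  by exists f.
have [F FP] := choice step.
pose phi := fix phi k : nat -> nat :=
  if k is k'.+1 then phi k' \o F (phi k', k') else id.
(* Every later extraction factors through [phi i] by an index map that stays above the identity;
   hence the diagonal inherits each limit. *)
have phi_tail i j : exists2 psi : nat -> nat, (forall n, (n <= psi n)%N) &
    phi (i + j)%N =1 phi i \o psi.
  elim: j => [|j [psi psi_ge psiE]]; first by exists id; rewrite ?addn0.
  exists (psi \o F (phi (i + j)%N, (i + j)%N)).
    move=> n /=; apply: leq_trans (psi_ge _).
    by apply: increasing_seq_ge; have [] := FP (phi (i + j)%N, (i + j)%N).
  by move=> n; rewrite addnS /= psiE.
exists (fun k => phi k k).
  move=> k; have [psi psi_ge psiE] := phi_tail 0%N k.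
  by rewrite -[k in phi k]add0n psiE /=.
move=> i; have [_ cvi] := FP (phi i, i); exists (limn (fun k => v i (phi i.+1 k))).
apply/cvgrPdist_lt => e e0; move/cvgrPdist_lt : cvi => /(_ e e0)[N _ NP].
exists (maxn N i.+1) => // k /=; rewrite geq_max => /andP[Nk ik].
have [psi psi_ge psiE] := phi_tail i.+1 (k - i.+1)%N.
have -> : phi k k = phi i.+1 (psi k) by rewrite -[RHS]psiE subnKC.
exact/NP/(leq_trans Nk (psi_ge k)).
Qed.

(** A diagonal subsequence converges at all rationals of the open unit interval. The limit is
    extended by suprema from the left, and convergence can fail only where there is a jump. *)
Lemma helly_selection (Q : nat -> R -> R) :
  (forall n, nondecreasing_fun (Q n)) ->
  (forall u : R, 0 < u < 1 -> exists M : R, forall n, `|Q n u| <= M) ->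
  exists (phi : nat -> nat) (F : R -> R),
    [/\ forall k, (k <= phi k)%N, measurable_fun setT F &
        countable [set u : R | 0 < u < 1 /\ ~ (Q (phi k) u @[k --> \oo] --> F u)]].
Proof.
move=> Qnd Qbnd.
(* [r] lists all rationals; a code that decodes to nothing yields 0, which the guard below
   discards. *)
pose r i : R := ratr (odflt 0 (unpickle i : option rat)).
have [i|phi phi_ge cvphi] := @diagonal_subsequence
    (fun i n => if 0 < r i < 1 then Q n (r i) else 0).
  by case: (boolP (0 < r i < 1)) => [/Qbnd //|_]; exists 0 => _; rewrite normr0.
have [L0 L0P] := choice cvphi.
pose I := fun q : rat => 0 < (ratr q : R) < 1.
have [L LP] : exists L : rat -> R, forall q, I q ->
    Q (phi k) (ratr q) @[k --> \oo] --> L q.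
  exists (fun q => L0 (pickle q)) => q q01.
  by have := L0P (pickle q); rewrite /r pickleK /= [0 < _ < _]q01.
have LE (e : R) : 0 < e -> forall q, I q -> \forall k \near \oo, `|L q - Q (phi k) (ratr q)| < e.
  by move=> e0 q /LP /cvgrPdist_lt /(_ e e0).
have Lnd q q' : I q -> I q' -> (ratr q : R) <= ratr q' -> L q <= L q'.
  move=> q01 q'01 qq'; apply: ler_cvg_to (LP q q01) (LP q' q'01) _.
  by apply: nearW => k; apply: Qnd.
pose F0 (u : R) := sup [set L q | q in [set q | I q /\ ratr q < u]].
have below (u : R) : 0 < u < 1 -> exists2 q, I q & ratr q < u.
  move=> /andP[u0 u1]; have [q] := rat_in_itvoo u0; rewrite in_itv /= => /andP[q0 qu].
  by exists q => //; rewrite /I q0 (lt_trans qu).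
have between (u v : R) : 0 < u -> u < v -> v <= 1 -> exists2 q, I q & u < ratr q < v.
  move=> u0 uv v1; have [q] := rat_in_itvoo uv; rewrite in_itv /= => /andP[uq qv].
  by exists q; rewrite /I ?uq ?qv ?(lt_trans u0) ?(lt_le_trans qv).
have sup_u (u : R) : 0 < u < 1 -> has_sup [set L q | q in [set q | I q /\ ratr q < u]].
  move=> u01; split; first by have [q] := below _ u01; exists (L q), q.
  have /andP[u0 u1] := u01.
  have [q q01 /andP[uq _]] := between u 1 u0 u1 (lexx _).
  exists (L q) => _ [q' [q'01 q'u] <-]; apply: Lnd => //.
  by rewrite ltW // (lt_trans q'u).
have F0_ge (u : R) (q : rat) : 0 < u < 1 -> I q -> ratr q < u -> L q <= F0 u.
  by move=> u01 q01 qu; apply: sup_upper_bound; [exact: sup_u|exists q].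
have F0_le (u : R) q : 0 < u < 1 -> I q -> u <= ratr q -> F0 u <= L q.
  move=> u01 q01 uq; apply: ge_sup; first by have [q'] := below _ u01; exists (L q'), q'.
  by move=> _ [q' [q'01 q'u] <-]; apply: Lnd => //; rewrite ltW // (lt_le_trans q'u).
have F0nd (u v : R) : 0 < u < 1 -> 0 < v < 1 -> u <= v -> F0 u <= F0 v.
  move=> u01 v01; rewrite [u <= v]le_eqVlt => /predU1P[->//|uv].
  have /andP[u0 _] := u01; have /andP[_ v1] := v01.
  have [q q01 /andP[uq qv]] := between u v u0 uv (ltW v1).
  by apply: (le_trans (F0_le u q u01 q01 (ltW uq))); exact: F0_ge.
(* On the open interval, monotonicity makes the preimages of upper rays intervals; outside it the
   limit is set to 0. *)
exists phi, (F0 \_ `]0, 1[%classic); split=> //.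
  apply: (measurable_restrictT F0 (measurable_itv _)).1.
  apply: (measurability (@RGenCInfty.G R)) => [|/= _ [_] [y] -> <-].
    exact: RGenCInfty.measurableE.
  apply: is_interval_measurable => s t /= [].
  rewrite !in_itv /= => s01; rewrite !andbT => ys [t01 yt] z /andP[sz zt].
  have z01 : 0 < z < 1.
    by move: s01 t01 => /andP[s0 _] /andP[_ t1]; rewrite (lt_le_trans s0) // (le_lt_trans zt).
  by split=> //; rewrite in_itv /= andbT (le_trans ys) // F0nd.
set D := [set u | _].
(* At a point of non-convergence [F0] jumps over a rational, and distinct points
   give distinct rationals. *)
have gap u : D u -> exists q : rat, F0 u < ratr q /\
    forall q', I q' -> u < ratr q' -> ratr q <= L q'.
  move=> [u01 ncv]; have /andP[u0 u1] := u01; apply: contrapT => nq; apply: ncv.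
  rewrite patchE mem_set; last by rewrite /= in_itv.
  apply/cvgrPdist_lt => e e0.
  (* The aim is [q1 < u < q2] with limits within [e / 2] of [F0 u]; monotonicity then traps
     [Q (phi k) u]. Without such a [q2], a rational just above [F0 u] would witness a jump. *)
  have [q1 [q101 q1u] q1F] : exists2 q, I q /\ ratr q < u & F0 u - e / 2 < L q.
    have [|_ [q [q01 qu] <-] Fq] := @sup_adherent _ _ (e / 2) _ (sup_u u u01).
      by rewrite divr_gt0.
    by exists q.
  have [q2 [q201 q2u] q2F] : exists2 q, I q /\ u < ratr q & L q < F0 u + e / 2.
    apply: contrapT => nq2; apply: nq.
    have [|q] := @rat_in_itvoo R (F0 u) (F0 u + e / 2); first by rewrite ltrDl divr_gt0.
    rewrite in_itv /= => /andP[Fq qF]; exists q; split=> // q' q'01 uq'.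
    rewrite leNgt; apply/negP => Lq; apply: nq2; exists q' => //.
    exact: lt_trans Lq qF.
  have e20 : 0 < e / 2 by rewrite divr_gt0.
  near=> k.
  have k1 : `|L q1 - Q (phi k) (ratr q1)| < e / 2 by near: k; exact: LE.
  have k2 : `|L q2 - Q (phi k) (ratr q2)| < e / 2 by near: k; exact: LE.
  have n1 := Qnd (phi k) _ _ (ltW q1u).
  have n2 := Qnd (phi k) _ _ (ltW q2u).
  move: k1 k2; rewrite !ltr_norml => /andP[_ k1] /andP[k2 _].
  by apply/andP; split; lra.
have [g gP] : exists g : R -> rat, forall u, D u -> F0 u < ratr (g u) /\
    forall q', I q' -> u < ratr q' -> ratr (g u) <= L q'.
  have [u|g gP] := @choice _ _ (fun u q => D u -> F0 u < (ratr q : R) /\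
     forall q', I q' -> u < ratr q' -> ratr q <= L q').
    have [/gap[q qP]|nD] := pselect (D u); first by exists q.
    by exists 0.
  by exists g.
(* For a rational [q] between [u] and [v], [g u <= L q <= F0 v < g v]. *)
have glt u v : D u -> D v -> u < v -> g u < g v.
  move=> Du Dv uv; have [[/andP[u0 _] _] [v01 _]] := (Du, Dv).
  have /andP[_ v1] := v01.
  have [q q01 /andP[uq qv]] := between u v u0 uv (ltW v1).
  rewrite -(ltr_rat R); apply: (le_lt_trans ((gP u Du).2 q q01 uq)).
  by apply: le_lt_trans (gP v Dv).1; exact: F0_ge.
apply/countable_injP; exists (pickle \o g) => u v; rewrite !inE => Du Dv.
move=> /(pcan_inj pickleK) guv; have [uv|vu|//] := ltgtP u v.
  by have := glt _ _ Du Dv uv; rewrite guv ltxx.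
by have := glt _ _ Dv Du vu; rewrite guv ltxx.
Unshelve. all: by end_near. Qed.

End Helly.

(** * From polynomial inequalities to moments *)

Section PolynomialIntegrals.
Context (R : realType).
Implicit Types (mu : probability (measurableTypeR R) R) (m : nat -> R) (p : {poly R}).

Lemma has_moments_poly mu m p : has_moments mu m ->
  mu.-integrable setT (fun x : R => (p.[x])%:E) /\
  (\int[mu]_x (p.[x])%:E = (mfunct m p)%:E)%E.
Proof.
move=> mum.
have int_term i : mu.-integrable setT (fun x : R => (p`_i)%:E * (x ^+ i)%:E)%E.
  by apply: integrableZl => //; exact: (mum i).1.
have pE : (fun x : R => (p.[x])%:E) =
    (fun x : R => \sum_(i < size p) ((p`_i)%:E * (x ^+ i)%:E)%E)%E.
  apply/funext => x; rewrite horner_coef -sumEFin; apply: eq_bigr => i _.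
  by rewrite EFinM.
split; first by rewrite pE; apply: integrable_sum.
rewrite pE integral_sum // -sumEFin; apply: eq_bigr => i _.
by rewrite integralZl ?(mum i).2 -?EFinM //; exact: (mum i).1.
Qed.

(** Fatou's lemma supplies only inequalities. They make even powers integrable, hence all powers.
    Since [m 0] is the total mass, constants contribute equally to both sides, which allows
    completing squares. *)
Lemma has_moments_le_poly mu m : m 0%N = 1 ->
  (forall p, (forall x, 0 <= p.[x]) ->
     (\int[mu]_x (p.[x])%:E <= (mfunct m p)%:E)%E) ->
  has_moments mu m.
Proof.
move=> m0 mule.
have mX n : measurable_fun setT (fun x : R => (x ^+ n)%:E).
  by apply/measurable_EFinP; apply: measurable_funX.
have int_even n : mu.-integrable setT (fun x : R => (x ^+ (n * 2))%:E).
  apply/integrableP; split; first exact: mX.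
  have X_ge0 (x : R) : 0 <= ('X^(n * 2)).[x] by rewrite hornerXn exprM sqr_ge0.
  have := mule _ X_ge0; rewrite mfunctXn => mum.
  apply: le_lt_trans (ltry (m (n * 2)%N)); apply: le_trans mum.
  rewrite le_eqVlt; apply/orP; left; apply/eqP/eq_integral => x _.
  by rewrite hornerXn abse_EFin ger0_norm // -hornerXn.
have int_pow n : mu.-integrable setT (fun x : R => (x ^+ n)%:E).
  apply: (@le_integrable _ _ _ mu setT measurableT (fun x : R => (x ^+ n)%:E)
    (fun x : R => (1%:E + (x ^+ (n * 2))%:E)%E)).
  - exact: mX.
  - move=> x _; rewrite -EFinD !abse_EFin lee_fin exprM.
    rewrite [leRHS]ger0_norm ?addr_ge0 ?sqr_ge0 // -real_normK ?num_real //.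
    by have := sqr_ge0 (`|x ^+ n| - 1); have := normr_ge0 (x ^+ n); nra.
  - by apply: integrableD => //; exact: finite_measure_integrable_cst.
pose I n : R := fine (\int[mu]_x (x ^+ n)%:E).
have muI : has_moments mu I.
  by move=> n; split=> //; rewrite fineK // integrable_fin_num.
have I0 : I 0%N = 1.
  rewrite /I; under eq_integral do rewrite expr0.
  by rewrite integral_cst // [X in (_ * X)%E]probability_setT mule1.
have Ile p : (forall x, 0 <= p.[x]) -> mfunct I p <= mfunct m p.
  by move=> p0; rewrite -lee_fin -(has_moments_poly p muI).2 mule.
suff mI n : m n = I n by move=> n; rewrite mI; exact: muI.
have m2_ge0 : 0 <= m (n * 2)%N.
  have X_ge0 (x : R) : 0 <= ('X^(n * 2)).[x] by rewrite hornerXn exprM sqr_ge0.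
  rewrite -mfunctXn; apply: le_trans (Ile _ X_ge0).
  rewrite -lee_fin -(has_moments_poly _ muI).2.
  by apply: integral_ge0 => x _; rewrite lee_fin.
(* [e y^2 + s y + 1/(4e)] is a square when [s^2 = 1]; bounding its integral for
   [s = 1] and [s = -1] and letting [e] tend to 0 gives [I n = m n]. *)
have key (e s : R) : 0 < e -> s ^+ 2 = 1 -> s * (I n - m n) <= e * m (n * 2)%N.
  move=> e0 s1.
  pose p : {poly R} := e *: 'X^(n * 2) + s *: 'X^n + ((e * 4)^-1)%:P.
  have p0 x : 0 <= p.[x].
    rewrite !hornerE exprM.
    have -> : e * (x ^+ n) ^+ 2 + s * x ^+ n + (e * 4)^-1 =
        e * (x ^+ n + s / (2 * e)) ^+ 2 + (1 - s ^+ 2) / (4 * e) by field; lra.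
    by rewrite s1 subrr mul0r addr0 mulr_ge0 ?sqr_ge0 ?ltW.
  have := Ile _ p0.
  rewrite !linearD !linearZ /= !mfunctXn !mfunctC I0 m0.
  suff : 0 <= I (n * 2)%N by nra.
  have X_ge0 (x : R) : 0 <= x ^+ (n * 2) by rewrite exprM sqr_ge0.
  by rewrite fine_ge0 // integral_ge0 // => x _; rewrite lee_fin.
suff Ile0 (s : R) : s ^+ 2 = 1 -> s * (I n - m n) <= 0.
  have N1 : (-1 : R) ^+ 2 = 1 by rewrite sqrrN expr1n.
  by have := Ile0 1 (expr1n _ _); have := Ile0 (-1) N1; lra.
move=> s1; apply/ler_addgt0Pr => e e0; rewrite add0r.
have M0 : 0 < m (n * 2)%N + 1 by rewrite ltr_wpDl.
(* [m (n * 2)] may vanish, hence the [+ 1] in the denominator. *)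
apply: le_trans (key (e / (m (n * 2)%N + 1)) s _ s1) _; first by rewrite divr_gt0.
by rewrite -mulrA ger_pMr // mulrC ler_pdivrMr // mul1r lerDl.
Qed.

End PolynomialIntegrals.

Section Existence.
Context (R : realType).
Local Notation leb := (@lebesgue_measure R).

(** Sorting the atoms makes [quant] monotone. All discrete measures thus become functions on one
    interval, as Helly selection requires. *)
Lemma quantile_of_atoms N (w x : 'I_N -> R) :
  (forall i, 0 <= w i) -> \sum_i w i = 1 ->
  exists2 Q : R -> R, nondecreasing_fun Q &
    forall h : R -> R, measurable_fun setT h -> (forall y, 0 <= h y) ->
      (\int[leb]_(u in `[0%R, 1%R[) (h (Q u))%:E = (\sum_i w i * h (x i))%R%:E)%E.
Proof.
move=> w0 w1; pose s := sort (relpre fst <=%R) [seq (x i, w i) | i <- enum 'I_N].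
have sE (F : R * R -> R) : \sum_(e <- s) F e = \sum_i F (x i, w i).
  by rewrite (perm_big _ (permEl (perm_sort _ _))) big_map big_enum.
have ss : path <=%R (head 0 (map fst s)) (map fst s).
  rewrite /s -sort_map; set t := sort _ _.
  have : sorted <=%R t by apply: sort_sorted; exact: le_total.
  by case: t => //= y t ->; rewrite lexx.
exists (quant 0 (head 0 (map fst s)) s); first exact: quant_homo.
move=> h mh h0; have := integral_quant 0 ss _ mh h0.
rewrite !sE /= w1 add0r => -> // e; rewrite mem_sort => /mapP[i _ ->].
exact: w0.
Qed.

(** A Chebyshev bound: the square of [Q] is at least its value at [u] on [[u, 1[] if [Q u >= 0], and
    on [[0, u[] otherwise. The final form uses [y <= 1 + y^2]. *)
Lemma second_moment_bound (Q : R -> R) (M u : R) : nondecreasing_fun Q ->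
  (\int[leb]_(v in `[0%R, 1%R[) (Q v ^+ 2)%:E <= M%:E)%E -> 0 < u < 1 ->
  `|Q u| <= 1 + M / (u * (1 - u)).
Proof.
move=> Qnd QM /andP[u0 u1].
have mQ D : measurable D -> measurable_fun D (fun v => (Q v ^+ 2)%:E).
  move=> mD; apply/measurable_EFinP; apply: measurable_funX.
  exact: nondecreasing_measurable.
have sub (a b : R) : 0 <= a -> a <= b -> b <= 1 ->
    (forall v, v \in `[a, b[ -> Q u ^+ 2 <= Q v ^+ 2) -> (b - a) * Q u ^+ 2 <= M.
  move=> a0 ab b1 Qle; rewrite -lee_fin; apply: le_trans QM.
  apply: (@le_trans _ _ (\int[leb]_(v in `[a, b[) (Q v ^+ 2)%:E)%E); last first.
    apply: ge0_subset_integral => //; first exact: mQ.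
      by move=> v _; rewrite lee_fin sqr_ge0.
    move=> v /=; rewrite !in_itv /= => /andP[av vb].
    by rewrite (le_trans a0) ?(lt_le_trans vb).
  have -> : ((b - a) * Q u ^+ 2)%:E = (\int[leb]_(v in `[a, b[) (cst (Q u ^+ 2)%:E v))%E.
    rewrite integral_cst //= lebesgue_measure_itv /= lte_fin.
    move: ab; rewrite le_eqVlt => /orP[/eqP->|ab].
      by rewrite ltxx mule0 subrr mul0r.
    by rewrite ab -EFinB -EFinM mulrC.
  apply: ge0_le_integral => //; last exact: mQ.
    by move=> v _; rewrite lee_fin sqr_ge0.
have uu0 : 0 < u * (1 - u) by rewrite mulr_gt0 // subr_gt0.
suff QM2 : u * (1 - u) * Q u ^+ 2 <= M.
  have QM3 : Q u ^+ 2 <= M / (u * (1 - u)) by rewrite ler_pdivlMr // mulrC.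
  apply: le_trans (lerD (lexx 1) QM3); rewrite -real_normK ?num_real //.
  by have := sqr_ge0 (`|Q u| - 1); have := normr_ge0 (Q u); nra.
have Q2 := sqr_ge0 (Q u).
have [Qu0|Qu0] := leP 0 (Q u).
  have /sub : 0 <= u by exact: ltW.
  move=> /(_ 1 (ltW u1) (lexx _)) H.
  have : (1 - u) * Q u ^+ 2 <= M.
    apply: H => v; rewrite in_itv /= => /andP[uv _].
    by have := Qnd _ _ uv; nra.
  by apply: le_trans; rewrite ler_wpM2r // ger_pMl ?subr_gt0 // ltW.
have : (u - 0) * Q u ^+ 2 <= M.
  apply: sub => //; try exact: ltW.
  move=> v; rewrite in_itv /= => /andP[_ vu].
  by have := Qnd _ _ (ltW vu); nra.
rewrite subr0; apply: le_trans; rewrite ler_wpM2r // ger_pMr //.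
by rewrite lerBlDr lerDl ltW.
Qed.

Lemma limn_einf_near_cst (f : nat -> \bar R) l :
  (\forall n \near \oo, f n = l) -> limn_einf f = l.
Proof. by move=> fl; rewrite (cvg_limn_einf_sup (cvg_near_cst _ fl)). Qed.

(** The measure is the law of the limiting quantile function under the uniform distribution. The
    offset in [n.+3] admits [X^2] for every [n], which bounds the [Q n] pointwise. *)
Lemma quantile_limit (Q : nat -> R -> R) (m : nat -> R) : m 0%N = 1 ->
  (forall n, nondecreasing_fun (Q n)) ->
  (forall n (p : {poly R}), (size p <= n.+3)%N -> (forall x, 0 <= p.[x]) ->
    (\int[leb]_(u in `[0%R, 1%R[) (p.[Q n u])%:E = (mfunct m p)%:E)%E) ->
  exists mu : probability (measurableTypeR R) R, has_moments mu m.
Proof.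
move=> m0 Qnd Qint.
have Qbnd (u : R) : 0 < u < 1 -> exists M : R, forall n, `|Q n u| <= M.
  move=> u01; exists (1 + m 2%N / (u * (1 - u))) => n.
  apply: second_moment_bound => //; rewrite -mfunctXn -(Qint n) ?size_polyXn //.
    by rewrite le_eqVlt; apply/orP; left; apply/eqP/eq_integral => v _; rewrite hornerXn.
  by move=> x; rewrite hornerXn sqr_ge0.
have [phi [F [phi_ge mF cD]]] := helly_selection Qnd Qbnd.
set D := (X in countable X) in cD.
pose X : {mfun measurableTypeR R >-> measurableTypeR R} := 
  @mfun_Sub _ _ (measurableTypeR R) (measurableTypeR R) F (mem_set mF).
pose P0 := uniform_prob (@ltr01 R).
pose mu : probability (measurableTypeR R) R := distribution P0 X.
exists mu; apply: has_moments_le_poly => // p p0.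
have mp h : measurable_fun setT h -> measurable_fun setT (fun u : R => (p.[h u])%:E).
  move=> mh; apply/measurable_EFinP.
  by apply: (@measurableT_comp _ _ _ _ _ _ (horner p)) => //; exact: measurable_poly.
rewrite ge0_integral_distribution; last 2 first.
- by apply: (mp idfun) => //; exact: measurable_id.
- by move=> y; rewrite lee_fin.
rewrite integral_uniform; last 2 first.
- exact: mp.
- by move=> y; rewrite lee_fin.
rewrite subr0 invr1 mul1e -integral_itv_bndo_bndc; last first.
  by apply: measurable_funTS; exact: mp.
(* [D] lies in the open interval while the integral includes 0, so this point joins the null set. *)
pose E : set R := D `|` [set 0].
have mD : measurable D by apply: countable_measurable => // t; exact: measurable_set1.
have mE : measurable E by exact: measurableU.
have E0 : leb E = 0.
  apply: null_set_setU => //; first exact: countable_lebesgue_measure0.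
  exact: lebesgue_measure_set1.
have mQ n : measurable_fun setT (Q n) by exact: nondecreasing_measurable.
have ge0p (h : R -> R) x : (0 <= (p.[h x])%:E)%E by rewrite lee_fin.
have drop_null (h : R -> R) : measurable_fun setT h ->
    (\int[leb]_(u in `[0%R, 1%R[) (p.[h u])%:E =
     \int[leb]_(u in `[0%R, 1%R[ `\` E) (p.[h u])%:E)%E.
  move=> mh; apply: ge0_negligible_integral => //.
  by apply: measurable_funTS; exact: mp.
change (\int[leb]_(u in `[0%R, 1%R[) (p.[F u])%:E <= (mfunct m p)%:E)%E.
rewrite drop_null //.
apply: (@le_trans _ _ (\int[leb]_(u in `[0%R, 1%R[ `\` E)
    limn_einf (fun k => (p.[Q (phi k) u])%:E))%E).
  rewrite le_eqVlt; apply/orP; left; apply/eqP/eq_integral => u.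
  rewrite inE /= in_itv /= => -[/andP[u0 u1] Eu].
  have cvu : Q (phi k) u @[k --> \oo] --> F u.
    apply: contrapT => ncv; apply: (Eu); left; split=> //.
    rewrite u1 andbT lt_neqAle u0 andbT; apply/eqP => u00; apply: Eu.
    by right; exact: esym u00.
  rewrite (cvg_limn_einf_sup (_ : _ --> (p.[F u])%:E)) //.
  apply: cvg_EFin; first exact: nearW.
  exact: (@continuous_cvg _ R R _ _ _ (horner p) (F u) (@continuous_horner R p (F u)) cvu).
apply: le_trans (fatou _ _ _ _) _ => //.
- exact: measurableD.
- by move=> n; apply: measurable_funTS; exact: mp.
rewrite (@limn_einf_near_cst _ (mfunct m p)%:E) //.
near=> k; rewrite -(Qint (phi k)) //; last first.
  have : (size p <= k)%N by near: k; exact: nbhs_infty_ge.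
  by move=> /leq_trans; apply; rewrite (leq_trans (phi_ge k)) // !leqW.
by rewrite [RHS]drop_null.
Unshelve. all: by end_near. Qed.

Lemma jvec_moments (a b : nat -> R) :
  exists mu : probability (measurableTypeR R) R, has_moments mu (jvec a b ^~ 0%N).
Proof.
have quant n : exists Q : R -> R, nondecreasing_fun Q /\
    forall (p : {poly R}), (size p <= n.+3)%N -> (forall x, 0 <= p.[x]) ->
    (\int[leb]_(u in `[0%R, 1%R[) (p.[Q u])%:E = (mfunct (jvec a b ^~ 0%N) p)%:E)%E.
  have [w [x [w0 wx]]] := quadrature a b n.+2.
  have [||Q Qnd Qint] := @quantile_of_atoms _ w x => //.
    transitivity (jvec a b 0 0) => //; rewrite wx //.
    by apply: eq_bigr => i _; rewrite mulr1.
  exists Q; split=> // p pn p0; rewrite Qint //; last exact: measurable_poly.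
  congr EFin; under eq_bigr do rewrite (horner_coef_wide _ pn) mulr_sumr.
  rewrite exchange_big (mfunctE _ pn); apply: eq_bigr => i _ /=.
  rewrite wx -1?ltnS // mulr_sumr; apply: eq_bigr => j _; ring.
have [Q QP] := choice quant.
apply: (@quantile_limit Q) => // [n|n p]; first exact: (QP n).1.
exact: (QP n).2.
Qed.

End Existence.

(** * Determinacy under Carleman's condition *)

Section Approximation.
Context (R : realType).
Variables (a b : nat -> R).
Hypothesis b_gt0 : forall k, 0 < b k.+1.

Local Notation m := (jvec a b ^~ 0%N).
Local Notation L := (mfunct m).

(** [f (k - 1)] with [f (-1) = 0]; generic, since three-term recurrences occur both for polynomials
    and for numbers. *)
Definition lag (V : zmodType) (f : nat -> V) (k : nat) : V :=
  if k is k'.+1 then f k' else 0.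

(** Carrying [p_k] together with [p_(k+1)] turns the two-step recurrence into a structural
    recursion. *)
Fixpoint opoly_pair (k : nat) : {poly R} * {poly R} :=
  if k is k'.+1 then
    let pq := opoly_pair k' in
    (pq.2, (b k.+1)^-1 *: (('X - (a k)%:P) * pq.2 - b k *: pq.1))
  else (1, (b 1)^-1 *: ('X - (a 0%N)%:P)).

Definition opoly k := (opoly_pair k).1.

Lemma opolyS k :
  b k.+1 *: opoly k.+1 = ('X - (a k)%:P) * opoly k - b k *: lag opoly k.
Proof.
rewrite /opoly; case: k => [|k] /=.
  by rewrite scalerA divff ?gt_eqF // scale1r mulr1 scaler0 subr0.
by rewrite scalerA divff ?gt_eqF // scale1r; case: k.
Qed.

Lemma mulX_opoly k :
  'X * opoly k = b k.+1 *: opoly k.+1 + a k *: opoly k + b k *: lag opoly k.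
Proof. by rewrite opolyS mulrBl mul_polyC addrAC subrK subrK. Qed.

Lemma jvecS n k : jvec a b n.+1 k =
  b k * lag (jvec a b n) k + a k * jvec a b n k + b k.+1 * jvec a b n k.+1.
Proof. by case: k => [|k] //=; rewrite mulr0. Qed.

(** In terms of [J], [p_k(J) e_0 = e_k], so [L (X^n p_k)] is the entry [k] of [J^n e_0]. *)
Lemma mfunct_Xn_opoly n k : L ('X^n * opoly k) = jvec a b n k.
Proof.
have [j] := ubnP k; elim: j k n => // j IHj [|k] n kj; first by rewrite mulr1 mfunctXn.
have bk := b_gt0 k; apply: (mulfI (lt0r_neq0 bk)).
have : L ('X^n * (b k.+1 *: opoly k.+1)) = b k.+1 * L ('X^n * opoly k.+1).
  by rewrite -scalerAr mfunctZ.
move=> <-; rewrite opolyS mulrBr mulrBl mulrBr mulrA -exprSr mul_polyC.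
rewrite -!scalerAr !linearB /= !mfunctZ !IHj // jvecS.
case: k kj {bk} => [|k] kj /=; first by rewrite !mulr0 linear0; ring.
by rewrite IHj; [ring|lia].
Qed.

(** A factor [X] can be moved from [p_j] to [p_k], which lowers [j]; the base case is
    [mfunct_Xn_opoly] with [n = 0]. *)
Lemma opoly_orthonormal j k : L (opoly j * opoly k) = (j == k)%:R.
Proof.
have [N] := ubnP j; elim: N j k => // N IHN [|j] k jN.
  by have := mfunct_Xn_opoly 0 k; rewrite expr0 eq_sym.
have bj := b_gt0 j; apply: (mulfI (lt0r_neq0 bj)).
have : L (b j.+1 *: opoly j.+1 * opoly k) = b j.+1 * L (opoly j.+1 * opoly k).
  by rewrite -scalerAl mfunctZ.
move=> <-; rewrite opolyS !mulrBl.
have -> : 'X * opoly j * opoly k = opoly j * ('X * opoly k) by ring.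
rewrite mulX_opoly !mulrDr mul_polyC -!(scalerAr, scalerAl) !(linearB, linearD).
rewrite /= !mfunctZ !IHN //.
have -> : L (opoly j * lag opoly k) = lag (fun i => (j == i)%:R) k.
  by case: k => [|k]; rewrite ?mulr0 ?linear0 //= IHN.
have -> : L (lag opoly j * opoly k) = lag (fun i => (i == k)%:R) j.
  by case: j jN {bj} => [|j] jN; rewrite ?mul0r ?linear0 //= IHN //; lia.
move: j k {jN bj} => [|j] [|k] /=; rewrite ?eqSS;
  by repeat (case: eqP => ?); try lia; subst; rewrite ?mulr0n ?mulr1n; ring.
Qed.

End Approximation.

(** * Polynomial approximation of the resolvent *)

Section Resolvent.
Context (R : realType).
Variables (x0 : R).

Local Notation Y := ('X - x0%:P : {poly R}).
Local Notation W := (Y ^+ 2 + 1).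

Definition evalc (p : {poly R}) : R[i] :=
  (map_poly (real_complex R) p).[(x0 +i* 1)%C].

Definition evRe p : R := complex.Re (evalc p).
Definition evIm p : R := complex.Im (evalc p).

Lemma evalc_mulXC p c :
  evRe (p * 'X + c%:P) = evRe p * x0 - evIm p + c /\
  evIm (p * 'X + c%:P) = evRe p + evIm p * x0.
Proof.
rewrite /evRe /evIm /evalc rmorphD rmorphM /= map_polyX map_polyC /=.
rewrite hornerD hornerM hornerX hornerC.
by case: (_.[_]) => u v /=; rewrite !mulr1 addr0.
Qed.

(** [W] vanishes at [z = x0 + i] and at its conjugate, and [Y] takes the value [i] at [z]; the
    remainder is the real affine polynomial with the value of [p] at [z]. *)
Lemma poly_mod_W p : exists t, p = (evRe p)%:P + evIm p *: Y + W * t.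
Proof.
elim/poly_ind: p => [|p c [t pE]].
  by exists 0; rewrite /evRe /evIm /evalc rmorph0 horner0 scale0r mulr0 !addr0.
have [-> ->] := evalc_mulXC p c.
exists ((evIm p)%:P + t * 'X); rewrite {1}pE -!mul_polyC.
by rewrite !(rmorphD, rmorphM, rmorphB) /=; ring.
Qed.

Variables (a b : nat -> R).
Hypothesis b_gt0 : forall k, 0 < b k.+1.
Local Notation m := (jvec a b ^~ 0%N).
Local Notation L := (mfunct m).
Local Notation p_ := (opoly a b).
Local Notation u := (fun k => evRe (p_ k)).
Local Notation v := (fun k => evIm (p_ k)).

Lemma evalc_opolyS k :
  b k.+1 * u k.+1 = (x0 - a k) * u k - v k - b k * lag u k /\
  b k.+1 * v k.+1 = (x0 - a k) * v k + u k - b k * lag v k.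
Proof.
have : ((b k.+1)%:C * evalc (p_ k.+1) = ((x0 +i* 1) - (a k)%:C) * evalc (p_ k)
    - (b k)%:C * (lag u k +i* lag v k))%C.
  have /(congr1 evalc) := opolyS a b_gt0 k.
  rewrite {1 2}/evalc -!mul_polyC !(rmorphB, rmorphM) /= !map_polyC map_polyX /=.
  rewrite !hornerE => ->; congr (_ - _ * _).
  case: k => [|k] /=; first by rewrite rmorph0 horner0.
  by rewrite /evRe /evIm /evalc; case: (_.[_]).
move: (lag u k) (lag v k) => lu lv; rewrite /evRe /evIm.
case: (evalc (p_ k.+1)) => u1 v1; case: (evalc (p_ k)) => u0 v0 [hu hv] /=.
by split; [move: hu|move: hv]; rewrite !mul0r ?subr0 ?addr0 => ->; ring.
Qed.

Lemma evalc_opoly0 : u 0%N = 1 /\ v 0%N = 0.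
Proof. by rewrite /evRe /evIm /evalc rmorph1 hornerC. Qed.

Definition kernel_diag n := \sum_(k < n) (u k ^+ 2 + v k ^+ 2).

(* Wronskian form of the Christoffel-Darboux identity at [(z, z^* )]. *)
Lemma kernel_diagE n :
  kernel_diag n.+1 = b n.+1 * (u n * v n.+1 - u n.+1 * v n).
Proof.
have wronskian k : b k.+1 * (u k * v k.+1 - u k.+1 * v k) =
    u k * (b k.+1 * v k.+1) - (b k.+1 * u k.+1) * v k by ring.
elim: n => [|n IHn].
  rewrite wronskian; have [-> ->] := evalc_opolyS 0; have [u0 v0] := evalc_opoly0.
  by rewrite /kernel_diag big_ord1 u0 v0 /=; ring.
rewrite /kernel_diag big_ord_recr /= -/(kernel_diag _) IHn [RHS]wronskian.
by have [-> ->] := evalc_opolyS n.+1; rewrite /=; ring.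
Qed.

(** As [p_0 = 1], the kernel is at least 1, so [b_(k+1)^-1] is at most the Wronskian, itself at most
    the mean of [|p_k(z)|^2] and [|p_(k+1)(z)|^2]. Summation counts each term at most twice. *)
Lemma kernel_diag_ge n : \sum_(k < n) (b k.+1)^-1 <= kernel_diag n.+1.
Proof.
have K0 k : 0 <= kernel_diag k.
  by apply: sumr_ge0 => i _; rewrite addr_ge0 ?sqr_ge0.
have K1 k : 1 <= kernel_diag k.+1.
  have [u0 v0] := evalc_opoly0.
  rewrite /kernel_diag big_ord_recl u0 v0 expr1n expr0n addr0 lerDl.
  by apply: sumr_ge0 => i _; rewrite addr_ge0 ?sqr_ge0.
pose d k := u k ^+ 2 + v k ^+ 2.
have inv_le k : (b k.+1)^-1 <= (d k + d k.+1) / 2.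
  have bk := b_gt0 k; rewrite -[leLHS]mul1r ler_pdivrMr //.
  apply: le_trans (K1 k) _; rewrite kernel_diagE mulrC ler_pM2r //.
  rewrite /d; have := sqr_ge0 (u k - v k.+1); have := sqr_ge0 (u k.+1 + v k).
  by nra.
apply: (@le_trans _ _ (\sum_(k < n) (d k + d k.+1) / 2)).
  by apply: ler_sum => k _.
rewrite -mulr_suml big_split /= ler_pdivrMr // mulr_natr mulr2n lerD //.
  by rewrite /kernel_diag big_ord_recr /= lerDl addr_ge0 ?sqr_ge0.
by rewrite /kernel_diag big_ord_recl /= lerDr addr_ge0 ?sqr_ge0.
Qed.

Hypothesis carleman : forall A : R, exists n, A <= \sum_(k < n) (b k.+1)^-1.

(* Division of [1 - K_n(x, z^* ) / K_n(z, z^* )] by [x - z], for [z = x0 + i],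
   yields a polynomial approximating [1 / (x - z)]. *)
Lemma approx_resolvent e : 0 < e -> exists s1 s2 rho : {poly R},
  [/\ forall x, `|(x - x0) / ((x - x0) ^+ 2 + 1) - s1.[x]| <= rho.[x],
      forall x, `|((x - x0) ^+ 2 + 1)^-1 - s2.[x]| <= rho.[x]
    & L rho <= e].
Proof.
(* This forces [K^-1 < e^2 / 4], the value that balances the two halves of [L rho]; the [+ 1] makes
   the bound strict. *)
move=> e0; have [n nK] := carleman (4 * e ^- 2 + 1).
pose K := kernel_diag n.+1.
have K_ge : 4 * e ^- 2 < K.
  by apply: lt_le_trans (kernel_diag_ge n); apply: lt_le_trans nK; rewrite ltrDl.
have K_gt0 : 0 < K.
  by apply: le_lt_trans K_ge; rewrite mulr_ge0 // invr_ge0 exprn_ge0 // ltW.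
have [t tP] := choice (fun k => poly_mod_W (p_ k)).
(* [r1 + i r2] is the normalised kernel, and [T] is the imaginary part of
   [(1 - r1 - i r2) / (x - z)], a polynomial by [poly_mod_W]. The real part is [Y * T + r2]. *)
pose r1 := K^-1 *: \sum_(k < n.+1) u k *: p_ k.
pose r2 := - (K^-1 *: \sum_(k < n.+1) v k *: p_ k).
pose T := K^-1 *: \sum_(k < n.+1) ((v k ^+ 2)%:P - ((u k)%:P - v k *: Y) * t k).
have WT : W * T = 1 - r1 - Y * r2.
  have one : K^-1 *: \sum_(k < n.+1) (u k ^+ 2 + v k ^+ 2)%:P = 1 :> {poly R}.
    by rewrite -rmorph_sum /= -alg_polyC scalerA mulVf ?gt_eqF // scale1r.
  rewrite -[X in X - r1 - _]one /r1 /r2 /T mulrN opprK -!scalerAr -scalerBr -scalerDr; congr (_ *: _).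
  rewrite !mulr_sumr -sumrB -big_split /=; apply: eq_bigr => k _.
  move: (p_ k) (t k) (evRe (p_ k)) (evIm (p_ k)) (tP k) => pk tk uk vk ->.
  by rewrite -!mul_polyC !(rmorphD, rmorphM, rmorphXn) /=; ring.
have L_sqr (c : nat -> R) : L ((K^-1 *: \sum_(k < n.+1) c k *: p_ k) ^+ 2) =
    K ^- 2 * \sum_(k < n.+1) c k ^+ 2.
  rewrite exprZn mfunctZ exprVn; congr (_ * _).
  rewrite expr2 mulr_suml linear_sum /=; apply: eq_bigr => k _.
  rewrite mulr_sumr linear_sum /= (bigD1 k) //= big1 => [|j jk].
    by rewrite -scalerAl -scalerAr !mfunctZ opoly_orthonormal // eqxx addr0 mulr1.
  rewrite -scalerAl -scalerAr !mfunctZ opoly_orthonormal // val_eqE eq_sym.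
  by rewrite (negbTE jk) !mulr0.
have Lr : L (r1 ^+ 2 + r2 ^+ 2) = K^-1.
  rewrite linearD /= /r1 /r2 sqrrN (L_sqr u) (L_sqr v) -mulrDr -big_split /= -/(kernel_diag _) -/K.
  by field; lra.
clearbody r1 r2 T; pose eta := e / 2.
have eta0 : 0 < eta by rewrite divr_gt0.
(* A polynomial majorant of the modulus of [r1 + i r2], from [2 |f| <= eta + f^2 / eta]. It bounds
   the error since [|x - z| >= 1]. *)
pose rho := eta%:P + eta^-1 *: (r1 ^+ 2 + r2 ^+ 2).
have bound x (f : R) : f ^+ 2 <= r1.[x] ^+ 2 + r2.[x] ^+ 2 -> `|f| <= rho.[x].
  move=> fr; rewrite /rho !hornerE.
  apply: (@le_trans _ _ (eta + eta^-1 * f ^+ 2)); last first.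
    by rewrite lerD2l ler_wpM2l // invr_ge0 ltW.
  rewrite -real_normK ?num_real //.
  have -> : eta + eta^-1 * `|f| ^+ 2 = eta^-1 * (`|f| - eta) ^+ 2 + 2 * `|f|.
    by field; lra.
  apply: ler_wpDl; first by rewrite mulr_ge0 ?sqr_ge0 // invr_ge0 ltW.
  by have := normr_ge0 f; lra.
have T_at x : ((x - x0) ^+ 2 + 1) * T.[x] = 1 - r1.[x] - (x - x0) * r2.[x].
  by have := congr1 (horner^~ x) WT; rewrite !hornerE.
exists (Y * T + r2), T, rho; split=> [x|x|].
- apply: bound; rewrite !hornerE.
  have := T_at x; move: (T.[x]) (r1.[x]) (r2.[x]) (x - x0) => tx s1 s2 y tE.
  have y0 : 0 < y ^+ 2 + 1 by rewrite ltr_wpDl ?sqr_ge0.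
  have -> : y / (y ^+ 2 + 1) - (y * tx + s2) = (y * s1 - s2) / (y ^+ 2 + 1).
    have -> : tx = (1 - s1 - y * s2) / (y ^+ 2 + 1).
      by rewrite -tE mulrAC divff ?mul1r // gt_eqF.
    by field; lra.
  rewrite expr_div_n ler_pdivrMr ?exprn_gt0 //.
  by nra.
- apply: bound.
  have := T_at x; move: (T.[x]) (r1.[x]) (r2.[x]) (x - x0) => tx s1 s2 y tE.
  have y0 : 0 < y ^+ 2 + 1 by rewrite ltr_wpDl ?sqr_ge0.
  have -> : (y ^+ 2 + 1)^-1 - tx = (s1 + y * s2) / (y ^+ 2 + 1).
    have -> : tx = (1 - s1 - y * s2) / (y ^+ 2 + 1).
      by rewrite -tE mulrAC divff ?mul1r // gt_eqF.
    by field; lra.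
  rewrite expr_div_n ler_pdivrMr ?exprn_gt0 //.
  by nra.
rewrite /rho linearD /= mfunctZ mfunctC mulr1 Lr.
rewrite /eta; have : K^-1 <= e ^+ 2 / 4.
  rewrite -[K^-1]mul1r ler_pdivrMr //.
  have e1 : e ^+ 2 / 4 * (4 * e ^- 2) = 1 by field; lra.
  by rewrite -[leLHS]e1 ler_wpM2l ?ltW // divr_gt0 ?exprn_gt0.
move=> Ke; apply: (@le_trans _ _ (e / 2 + (e / 2)^-1 * (e ^+ 2 / 4))).
  by rewrite lerD2l ler_wpM2l // invr_ge0 ltW // divr_gt0.
by rewrite le_eqVlt; apply/orP; left; apply/eqP; field; lra.
Qed.

End Resolvent.

(** * Powers converging to a step function *)

Section PointwiseLimit.
Context (R : realType).
Implicit Types (x q t : R) (n : nat).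

Lemma bernoulli_ge x n : -1 <= x -> 1 + n%:R * x <= (1 + x) ^+ n.
Proof.
move=> x1; elim: n => [|n IHn]; first by rewrite mul0r addr0 expr0.
rewrite exprSr; have x0 : 0 <= 1 + x by lra.
apply: le_trans (ler_wpM2r x0 IHn).
by rewrite -natr1; have := ler0n R n; have := sqr_ge0 x; nra.
Qed.

(** With [q <= r^2] and [r < 1], one factor [r^n] absorbs [n] by Bernoulli's inequality and the
    other tends to 0. *)
Lemma cvg_natr_geometric q : 0 <= q < 1 -> n%:R * q ^+ n @[n --> \oo] --> (0 : R).
Proof.
move=> /andP[q0 q1]; pose r := (1 + Num.sqrt q) / 2.
have sq0 := sqrtr_ge0 q.
have sq1 : Num.sqrt q < 1 by rewrite -[ltRHS]sqrtr1 ltr_sqrt.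
have r0 : 0 < r by rewrite /r; lra.
have r1 : r < 1 by rewrite /r; lra.
have qr : q <= r ^+ 2.
  by rewrite -[leLHS]sqr_sqrtr // /r; nra.
pose h := r^-1 - 1.
have h0 : 0 < h by rewrite subr_gt0 invf_gt1.
have hE : 1 + h = r^-1 by rewrite /h addrC subrK.
clearbody h r.
have bnd n : 0 <= n%:R * q ^+ n <= h^-1 * r ^+ n.
  rewrite mulr_ge0 ?exprn_ge0 //=.
  have hn : 1 + n%:R * h <= r ^- n by rewrite -exprVn -hE bernoulli_ge //; lra.
  have rn : 0 < r ^+ n by rewrite exprn_gt0.
  apply: (@le_trans _ _ (n%:R * (r ^+ n * r ^+ n))).
    by rewrite ler_wpM2l // -exprD addnn -mul2n exprM lerXn2r ?nnegrE ?sqr_ge0.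
  rewrite mulrA (ler_wpM2r (ltW rn)) // -[h^-1]mulr1 ler_pdivlMl //.
  move: hn; rewrite -(ler_pM2r rn) mulVf ?gt_eqF // => hn.
  by nra.
apply: (@squeeze_cvgr _ _ _ _ (cst 0) (fun n => h^-1 * r ^+ n)).
- exact: nearW.
- exact: cvg_cst.
- rewrite -[X in _ --> X](mulr0 h^-1); apply: cvgMr.
  by apply: cvg_expr; rewrite ger0_norm ?ltW.
Qed.

(* The factor [n] in the exponent makes the limit 0 at the threshold [t = 1/2]. *)
Lemma cvg_step_power t : 0 <= t <= 1 ->
  (1 - t ^+ n) ^+ (n * 2 ^ n)%N @[n --> \oo] --> ((t < 2^-1)%R%:R : R).
Proof.
move=> /andP[t0 t1].
have tn n : 0 <= t ^+ n <= 1 by rewrite exprn_ge0 //= exprn_ile1.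
have f01 n : 0 <= (1 - t ^+ n) ^+ (n * 2 ^ n)%N <= 1.
  have /andP[? ?] := tn n.
  by rewrite exprn_ge0 ?exprn_ile1 // ?subr_ge0 //; lra.
have NtE n : (n * 2 ^ n)%N%:R * t ^+ n = n%:R * (2 * t) ^+ n.
  by rewrite natrM natrX exprMn mulrA.
have [t2|t2] := ltP t 2^-1.
  apply: (@squeeze_cvgr _ _ _ _ (fun n => 1 - n%:R * (2 * t) ^+ n) (cst 1)).
  - apply: nearW => n; have /andP[_ ->] := f01 n; rewrite andbT -NtE -mulrN.
    by apply: bernoulli_ge; have /andP[? ?] := tn n; lra.
  - rewrite -[X in _ --> X]subr0; apply: cvgB; first exact: cvg_cst.
    by apply: cvg_natr_geometric; apply/andP; split; lra.
  - exact: cvg_cst.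
(* For [s = t^n] and [N] the exponent, [(1 - s)^N (1 + s)^N <= 1], while
   [(1 + s)^N >= 1 + N s >= 1 + n] because [2 t >= 1]. *)
apply: (@squeeze_cvgr _ _ _ _ (cst 0) (@harmonic R)).
- apply: nearW => n; have /andP[-> _] := f01 n; rewrite /= /harmonic /=.
  have /andP[tn0 tn1] := tn n.
  rewrite -[leRHS]mul1r ler_pdivlMr //.
  have tN : n%:R <= (n * 2 ^ n)%N%:R * t ^+ n.
    by rewrite NtE ler_peMr // exprn_ege1 //; lra.
  have B : n.+1%:R <= (1 + t ^+ n) ^+ (n * 2 ^ n)%N.
    apply: le_trans (bernoulli_ge _ _); last by lra.
    by rewrite -natr1 addrC lerD2l.
  apply: le_trans (ler_wpM2l _ B) _; first by case/andP: (f01 n).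
  rewrite -exprMn exprn_ile1 //; nra.
- exact: cvg_cst.
- exact: cvg_harmonic.
Qed.

End PointwiseLimit.

(** * Approximation in mean by polynomials *)

Section Determinacy.
Context (R : realType).
Variable m : nat -> R.
Local Notation L := (mfunct m).

(* Stated through [L] only, so that the approximation is uniform over all the
   measures with moments [m]. *)
Definition approximable (f : R -> R) := forall e, 0 < e ->
  exists s rho : {poly R},
    (forall x, `|f x - s.[x]| <= rho.[x]) /\ L rho <= e.

(** [s - rho] and [s + rho] enclose [f], and their integrals are fixed by the moments and differ by
    [2 L rho]. *)
Lemma approximable_integral (mu nu : probability (measurableTypeR R) R) f :
  has_moments mu m -> has_moments nu m -> approximable f ->
  measurable_fun setT f -> (forall x, `|f x| <= 1) ->
  (\int[mu]_x (f x)%:E = \int[nu]_x (f x)%:E)%E.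
Proof.
move=> mum num apf mf f1.
have intf (P : probability (measurableTypeR R) R) : P.-integrable setT (EFin \o f).
  apply: (@le_integrable _ _ _ P setT measurableT _ (EFin \o cst 1)).
  - exact/measurable_EFinP.
  - by move=> x _ /=; rewrite lee_fin normr1.
  - exact: finite_measure_integrable_cst.
pose I (P : probability (measurableTypeR R) R) : R := fine (\int[P]_x (f x)%:E).
have IE (P : probability (measurableTypeR R) R) : (\int[P]_x (f x)%:E = (I P)%:E)%E.
  by rewrite fineK // integrable_fin_num //; exact: intf.
suff key (P Q : probability (measurableTypeR R) R) : has_moments P m -> has_moments Q m -> I P <= I Q.
  by rewrite !IE; congr EFin; apply/eqP; rewrite eq_le !key.
move=> Pm Qm; apply/ler_addgt0Pr => e e0.
have [|s [rho [frho Lrho]]] := apf (e / 2); first by rewrite divr_gt0.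
have PI : I P <= L (s + rho).
  have [intp pE] := has_moments_poly (s + rho) Pm.
  rewrite -lee_fin -IE -pE; apply: le_integral => // [|x _].
    exact: intf.
  by rewrite lee_fin hornerD; have := frho x; rewrite ler_norml => /andP[? ?]; lra.
have QI : L (s - rho) <= I Q.
  have [intp pE] := has_moments_poly (s - rho) Qm.
  rewrite -lee_fin -IE -pE; apply: le_integral => // [|x _].
    exact: intf.
  by rewrite lee_fin hornerD hornerN; have := frho x; rewrite ler_norml => /andP[? ?]; lra.
by move: PI QI; rewrite linearD linearB /=; lra.
Qed.

Lemma approximable1 : approximable (cst 1).
Proof.
move=> e e0; exists 1, 0; split; last by rewrite linear0 ltW.
by move=> x; rewrite hornerC horner0 subrr normr0.
Qed.

Lemma approximableD f g c : approximable f -> approximable g ->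
  approximable (fun x => f x + c * g x).
Proof.
move=> apf apg e e0.
have [|s [rho [sf Ls]]] := apf (e / 2); first by rewrite divr_gt0.
have c0 : 0 < `|c| + 1 by have := normr_ge0 c; lra.
have [|s' [rho' [sg Ls']]] := apg (e / 2 / (`|c| + 1)).
  by rewrite !divr_gt0.
exists (s + c *: s'), (rho + `|c| *: rho'); split.
  move=> x; rewrite !hornerE opprD addrACA -mulrBr.
  by apply: le_trans (ler_normD _ _) _; rewrite lerD // normrM ler_wpM2l.
rewrite linearD /= mfunctZ; move: Ls'; rewrite ler_pdivlMr // => Ls'.
have := normr_ge0 c.
(* [m] is arbitrary here, so [L rho'] may be negative although [rho'] is nonnegative. *)
have [Lr|Lr] := leP 0 (L rho'); nra.
Qed.

End Determinacy.

Section Carleman.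
Context (R : realType).
Variables (a b : nat -> R).
Hypothesis b_gt0 : forall k, 0 < b k.+1.
Hypothesis carleman : forall A : R, exists n, A <= \sum_(k < n) (b k.+1)^-1.
Local Notation m := (jvec a b ^~ 0%N).
Local Notation L := (mfunct m).

(* The real part of [1 / (x - z)] for [z = x0 + i]. *)
Definition cayley_re (x0 x : R) := (x - x0) / ((x - x0) ^+ 2 + 1).

Lemma cayley_re_le x0 x : `|cayley_re x0 x| <= 2^-1.
Proof.
rewrite /cayley_re; move: (x - x0) => y.
have y0 : 0 < y ^+ 2 + 1 by rewrite ltr_wpDl ?sqr_ge0.
rewrite normrM normfV (gtr0_norm y0) ler_pdivrMr // -real_normK ?num_real //.
by have := sqr_ge0 (`|y| - 1); nra.
Qed.

(** Replace [f] by a polynomial [s = A + B Y + W t]. Its product with [Y / W] is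
    [A Y / W + B - B / W + Y t], where only the two parts of the resolvent need approximating. *)
Lemma approximable_cayley x0 f : approximable m f ->
  approximable m (fun x => cayley_re x0 x * f x).
Proof.
move=> apf e e0.
have [|s [rho [fs Lrho]]] := apf (e / 2); first by rewrite divr_gt0.
have [t sE] := poly_mod_W x0 s; set A := evRe x0 s in sE; set B := evIm x0 s in sE.
have AB0 : 0 < `|A| + `|B| + 1 by rewrite ltr_wpDl // addr_ge0.
have [|s1 [s2 [rho' [s1E s2E Lrho']]]] :=
    @approx_resolvent R x0 a b b_gt0 carleman (e / 2 / (`|A| + `|B| + 1)).
  by rewrite !divr_gt0.
exists (A *: s1 + B%:P - B *: s2 + ('X - x0%:P) * t),
  (rho + (`|A| + `|B|) *: rho'); split=> [x|]; last first.
  rewrite linearD /= mfunctZ; move: Lrho'; rewrite ler_pdivlMr // => Lrho'.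
  by have := addr_ge0 (normr_ge0 A) (normr_ge0 B); have [|] := leP 0 (L rho'); nra.
have := fs x; have := s1E x; have := s2E x; have := cayley_re_le x0 x.
rewrite -/(cayley_re x0 x) !hornerE; set y := x - x0; set ph := cayley_re x0 x.
have y0 : 0 < y ^+ 2 + 1 by rewrite ltr_wpDl ?sqr_ge0.
set ps := (y ^+ 2 + 1)^-1; move=> ph1 ps_s2 ph_s1 fsx.
have -> : ph * f x - (A * s1.[x] + B - B * s2.[x] + y * t.[x]) =
    ph * (f x - s.[x]) + (A * (ph - s1.[x]) - B * (ps - s2.[x])).
  have -> : s.[x] = A + B * y + (y ^+ 2 + 1) * t.[x].
    by rewrite [in LHS]sE !hornerE.
  by rewrite /ph /cayley_re -/y /ps; field; lra.
apply: le_trans (ler_normD _ _) _; apply: lerD.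
  rewrite normrM; apply: le_trans fsx; rewrite ler_piMl //.
  by apply: le_trans ph1 _; lra.
apply: le_trans (ler_normB _ _) _; rewrite mulrDl !normrM.
by apply: lerD; apply: ler_wpM2l.
Qed.

(** The shift by 1/2 brings the values into [[0, 1]] and the sign change at [x0] to the threshold of
    [cvg_step_power]. *)
Definition step_base (x0 x : R) := 2^-1 + cayley_re x0 x.

Lemma step_base01 x0 x : 0 <= step_base x0 x <= 1.
Proof.
by have := cayley_re_le x0 x; rewrite ler_norml /step_base => /andP[? ?]; apply/andP; split; lra.
Qed.

Lemma step_base_lt x0 x : (step_base x0 x < 2^-1) = (x < x0).
Proof.
rewrite /step_base gtrDl /cayley_re.
have y0 : 0 < (x - x0) ^+ 2 + 1 by rewrite ltr_wpDl ?sqr_ge0.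
by rewrite pmulr_llt0 ?invr_gt0 // subr_lt0.
Qed.

Lemma approximable_step_base x0 f n : approximable m f ->
  approximable m (fun x => step_base x0 x ^+ n * f x).
Proof.
move=> apf; elim: n => [|n IHn].
  by congr (approximable m _) : apf; apply/funext => x; rewrite mul1r.
have := approximableD 2^-1 (approximable_cayley x0 IHn) IHn.
congr (approximable m _); apply/funext => x.
by rewrite exprS /step_base; ring.
Qed.

Lemma approximable_step x0 n N :
  approximable m (fun x => (1 - step_base x0 x ^+ n) ^+ N).
Proof.
elim: N => [|N IHN].
  by have := @approximable1 R m; congr (approximable m _).
have := approximableD (-1) IHN (approximable_step_base x0 n IHN).
congr (approximable m _); apply/funext => x.
by rewrite exprS; ring.
Qed.

Lemma step_le1 x0 n N x : `|(1 - step_base x0 x ^+ n) ^+ N| <= 1.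
Proof.
have /andP[s0 s1] := step_base01 x0 x.
have sn0 : 0 <= step_base x0 x ^+ n by rewrite exprn_ge0.
have sn1 : step_base x0 x ^+ n <= 1 by rewrite exprn_ile1.
by rewrite normrX exprn_ile1 // ger0_norm; lra.
Qed.

Lemma measurable_step x0 n N :
  measurable_fun setT (fun x => (1 - step_base x0 x ^+ n) ^+ N).
Proof.
apply: measurable_funX; apply: measurable_funB => //; apply: measurable_funX.
apply: measurable_funD => //; apply: continuous_measurable_fun => x.
have y0 : (x - x0) ^+ 2 + 1 != 0 by rewrite gt_eqF // ltr_wpDl ?sqr_ge0.
have cy : (fun x => x - x0) y @[y --> x] --> x - x0.
  by apply: cvgB; [exact: cvg_id|exact: cvg_cst].
by apply: cvgM => //; apply: cvgV => //; apply: cvgD; [exact: (cvgM cy cy)|exact: cvg_cst].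
Qed.

Lemma cvg_step_integral (mu : probability (measurableTypeR R) R) x0 :
  (\int[mu]_x ((1 - step_base x0 x ^+ n) ^+ (n * 2 ^ n)%N)%:E)%E @[n --> \oo]
    --> mu `]-oo, x0[%classic.
Proof.
pose f n x := ((1 - step_base x0 x ^+ n) ^+ (n * 2 ^ n)%N)%:E.
have [] := @dominated_convergence _ _ _ mu setT measurableT f
    (fun x => (\1_(`]-oo, x0[%classic) x)%:E) (cst 1%:E).
- by move=> n; apply/measurable_EFinP; exact: measurable_step.
- by apply/measurable_EFinP; exact: measurable_indic.
- apply: aeW => x _; apply: cvg_EFin; first exact: nearW.
  rewrite indicE mem_setE in_itv /= -(step_base_lt x0 x).
  exact: cvg_step_power (step_base01 x0 x).
- exact: finite_measure_integrable_cst.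
- by apply: aeW => x n _; rewrite lee_fin; exact: step_le1.
by move=> _ _; rewrite integral_indic // setIT.
Qed.

(** Open left rays are stable under intersection, exhaust the line and generate the Borel sets, so
    agreement on them suffices. *)
Lemma carleman_determinate : moment_determinate m.
Proof.
move=> mu nu mum num.
have ray x0 : mu `]-oo, x0[%classic = nu `]-oo, x0[%classic.
  have cvmu := @cvg_step_integral mu x0; have cvnu := @cvg_step_integral nu x0.
  have E : (fun n => \int[mu]_x ((1 - step_base x0 x ^+ n) ^+ (n * 2 ^ n)%N)%:E)%E =
      (fun n => \int[nu]_x ((1 - step_base x0 x ^+ n) ^+ (n * 2 ^ n)%N)%:E)%E.
    apply/funext => n; apply: (approximable_integral mum num).
    - exact: approximable_step.
    - exact: measurable_step.
    - by move=> x; exact: step_le1.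
  by rewrite E in cvmu; exact: (cvg_unique (@ereal_hausdorff R) cvmu cvnu).
apply: (@measure_unique _ R (measurableTypeR R) (@RGenInftyO.G R)
  (fun n => `]-oo, n%:R[%classic) _ _ _ _ mu nu).
- exact: RGenInftyO.measurableE.
- move=> _ _ [x ->] [y ->]; exists (Order.min x y).
  by apply/seteqP; split=> z /=; rewrite !in_itv /= lt_min; [case=> -> ->|move/andP].
- by move=> n; exists n%:R.
- apply/seteqP; split=> // x _; exists (Num.trunc `|x|).+1 => //=.
  by rewrite in_itv /= (le_lt_trans (ler_norm x)) // truncnS_gt.
- by move=> _ [x ->]; exact: ray.
- by move=> k; rewrite (le_lt_trans (probability_le1 _ _)) // ltry.
Qed.

End Carleman.

(** * Finitely supported measures *)

Section FiniteSupport.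
Context (R : realType).
Implicit Types (mu nu : probability (measurableTypeR R) R) (s : seq R).

Lemma setU_cons (x : R) s : [set` x :: s] = [set x] `|` [set` s].
Proof.
by apply/seteqP; split=> y /=; rewrite in_cons;
  [case/orP => [/eqP|]; [left|right]|case=> [->|->]; rewrite ?eqxx ?orbT].
Qed.

Lemma measurable_seq s : measurable ([set` s] : set (measurableTypeR R)).
Proof.
elim: s => [|x s IHs]; first by rewrite set_nil.
by rewrite setU_cons; apply: measurableU => //; exact: measurable_set1.
Qed.

Lemma measurable_polyE (p : {poly R}) :
  measurable_fun setT (fun x : measurableTypeR R => (p.[x])%:E).
Proof.
by apply/measurable_EFinP; exact: measurable_poly.
Qed.

Lemma measure_seq mu s : uniq s ->
  mu [set` s] = (\sum_(x <- s) mu [set x])%E.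
Proof.
elim: s => [|x s IHs] /=; first by rewrite set_nil measure0 big_nil.
move=> /andP[xs us]; rewrite setU_cons big_cons -IHs // measureU //.
- exact: measurable_seq.
- by apply/seteqP; split=> // y [/= ->]; exact/negP.
Qed.

Lemma measure_supp mu s (A : set (measurableTypeR R)) : uniq s ->
  mu [set` s] = 1%E -> measurable A ->
  mu A = (\sum_(x <- s | x \in A) mu [set x])%E.
Proof.
move=> us mus mA; have ms := measurable_seq s.
have -> : mu A = mu [set` [seq x <- s | x \in A]].
  have -> : [set` [seq x <- s | x \in A]] = A `&` [set` s].
    by apply/seteqP; split=> x /=; rewrite mem_filter; [move=> /andP[/set_mem]|move=> [/mem_set -> ->]].
  transitivity (mu (A `\` [set` s]) + mu (A `&` [set` s]))%E; first exact: measureDI.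
  suff -> : mu (A `\` [set` s]) = 0%E by rewrite add0e.
  apply/eqP; rewrite eq_le measure_ge0 andbT.
  have <- : mu (~` [set` s]) = 0%E by rewrite probability_setC // mus subee.
  apply: le_measure; rewrite ?inE //; first exact: measurableD.
  exact: measurableC.
by rewrite measure_seq ?filter_uniq // big_filter.
Qed.

Variable m : nat -> R.
Local Notation L := (mfunct m).

Lemma mfunct_mul_eq0 (P : {poly R}) : (forall n, L ('X^n * P) = 0) ->
  forall q, L (q * P) = 0.
Proof.
move=> P0 q; rewrite -[q]coefK poly_def mulr_suml linear_sum big1 // => i _ /=.
by rewrite -scalerAl mfunctZ P0 mulr0.
Qed.

(** The nonnegative function [P^2] has integral 0, so [P] vanishes almost everywhere. *)
Lemma annihilated_support mu (P : {poly R}) s : has_moments mu m ->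
  L (P * P) = 0 -> (forall x, root P x -> x \in s) -> mu [set` s] = 1%E.
Proof.
move=> mum LP Ps; have ms := measurable_seq s.
have mP2 : measurable_fun setT (fun x : measurableTypeR R => ((P * P).[x])%:E).
  exact: measurable_polyE.
have : ae_eq mu setT (fun x : measurableTypeR R => ((P * P).[x])%:E) (cst 0%E).
  apply/(ae_eq_integral_abs mu measurableT mP2).
  rewrite -[RHS]/(0%:E) -LP -(has_moments_poly (P * P) mum).2.
  apply: eq_integral => x _; rewrite abse_EFin ger0_norm //.
  by rewrite hornerM -expr2 sqr_ge0.
move=> [N [mN N0 sN]].
have sC0 : mu (~` [set` s]) = 0%E.
  apply/eqP; rewrite eq_le measure_ge0 andbT -N0.
  apply: le_measure; rewrite ?inE //; first exact: measurableC.
  move=> x /= xs; apply: sN => /= /(_ I) [] /eqP.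
  by rewrite hornerM mulf_eq0 orbb => /Ps.
have fs : mu [set` s] \is a fin_num by exact: fin_num_measure.
have := probability_setC mu ms; rewrite sC0 -(fineK fs) -EFinB => -[/eqP].
by rewrite eq_sym subr_eq0 => /eqP <-.
Qed.

(** [p] agrees almost everywhere with the indicator of [x]. *)
Lemma atom_weight mu s (p : {poly R}) x : has_moments mu m ->
  mu [set` s] = 1%E -> x \in s -> p.[x] = 1 ->
  (forall y, y \in s -> y != x -> p.[y] = 0) -> mu [set x] = (L p)%:E.
Proof.
move=> mum mus xs px py; have ms := measurable_seq s.
rewrite -(has_moments_poly p mum).2 -[in LHS](setIT [set x]).
rewrite -(integral_indic mu measurableT (measurable_set1 x)).
apply: ae_eq_integral => //.
- by apply/measurable_EFinP; exact: measurable_indic.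
- exact: measurable_polyE.
exists (~` [set` s]); split.
- exact: measurableC.
- by have := probability_setC mu ms; rewrite mus subee.
move=> y /= ne ys; apply: ne => _; congr EFin; rewrite indicE.
have [->|yx] := eqVneq y x; first by rewrite px mem_set.
by rewrite py // memNset //= => /eqP; rewrite (negbTE yx).
Qed.

(** Lagrange interpolation polynomials on [s] express all weights through [L] alone. *)
Lemma finite_support_determinate (P : {poly R}) s : uniq s ->
  L (P * P) = 0 -> (forall x, root P x -> x \in s) -> moment_determinate m.
Proof.
move=> us LP Ps mu nu mum num A mA.
have mus := annihilated_support mum LP Ps.
have nus := annihilated_support num LP Ps.
rewrite (measure_supp us mus mA) (measure_supp us nus mA) big_seq_cond [RHS]big_seq_cond.
apply: eq_bigr => x /andP[xs _].
pose q := \prod_(y <- rem x s) ('X - y%:P).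
have qx : q.[x] != 0.
  by rewrite -rootE root_prod_XsubC mem_rem_uniq // inE eqxx.
have lag1 : (q.[x]^-1 *: q).[x] = 1 by rewrite hornerZ mulVf.
have lag0 y : y \in s -> y != x -> (q.[x]^-1 *: q).[y] = 0.
  move=> ys yx; rewrite hornerZ; have /eqP -> : root q y; last by rewrite mulr0.
  by rewrite root_prod_XsubC mem_rem_uniq // inE yx.
by rewrite (atom_weight mum mus xs lag1 lag0) (atom_weight num nus xs lag1 lag0).
Qed.

End FiniteSupport.

(** * The parameters of the theorem *)

Section Bracket.
Context (R : realFieldType).
Implicit Types (x y : R) (n : nat).

Lemma xybracket1 x y : xybracket 1 x y = 1.
Proof. by rewrite /xybracket big_ord1 mulr1. Qed.

Lemma xybracket2 x y : xybracket 2 x y = x + y.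
Proof. by rewrite /xybracket !big_ord_recr big_ord0 /= expr0 expr1 mulr1 mul1r add0r. Qed.

(** The larger of [x] and [y] exceeds the other in absolute value; if they differ, the factorisation
    of [x^(n+1) - y^(n+1)] gives the sign. *)
Lemma xybracket_gt0 n x y : - y < x -> 0 < xybracket n.+1 x y.
Proof.
move=> yx; have pow_lt (z w : R) : - w < z -> w < z -> w ^+ n.+1 < z ^+ n.+1.
  move=> wz1 wz2; have wz : `|w| < z by rewrite ltr_norml ltrNl wz1.
  apply: le_lt_trans (_ : `|w| ^+ n.+1 < _); first by rewrite -normrX ler_norm.
  by rewrite ltrXn2r ?nnegrE // ltW // (le_lt_trans _ wz).
have [xy|yx'|xy] := ltgtP x y.
- have : 0 < (y - x) * xybracket n.+1 x y.
    by rewrite -opprB mulNr /xybracket -subrXX opprB subr_gt0 pow_lt // ltrNl.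
  by rewrite pmulr_rgt0 // subr_gt0.
- have : 0 < (x - y) * xybracket n.+1 x y.
    by rewrite /xybracket -subrXX subr_gt0 pow_lt.
  by rewrite pmulr_rgt0 // subr_gt0.
rewrite -xy in yx *; have x0 : 0 < x by lra.
rewrite /xybracket big_ord_recl ltr_wpDr // ?mulr_gt0 ?exprn_gt0 //.
by apply: sumr_ge0 => i _; rewrite mulr_ge0 ?exprn_ge0 // ltW.
Qed.

(** Used when [c < - d] and [h < - l]: the signs of the two brackets cancel in [beta]. *)
Lemma xybracketN n x y : xybracket n.+1 (- x) (- y) = (-1) ^+ n * xybracket n.+1 x y.
Proof.
rewrite /xybracket mulr_sumr; apply: eq_bigr => i _ /=.
rewrite (exprNn x) (exprNn y) mulrACA -exprD subnK //.
by rewrite -ltnS.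
Qed.

Lemma xybracket_le n x y :
  `|xybracket n.+1 x y| <= n.+1%:R * Num.max `|x| `|y| ^+ n.
Proof.
apply: le_trans (ler_norm_sum _ _ _) _.
rewrite mulr_natl -[n.+1 in leRHS]card_ord -sumr_const; apply: ler_sum => i _ /=.
have i_n : (i <= n)%N by rewrite -ltnS.
rewrite normrM !normrX -[n in leRHS](subnK i_n) exprD.
by apply: ler_pM; rewrite ?exprn_ge0 // lerXn2r ?nnegrE ?le_max ?lexx ?normr_ge0 ?orbT.
Qed.

End Bracket.

Section JacobiParameters.
Context (R : realType).
Variables (al be : nat -> R).

(** A zero [be 2] multiplies everything deeper in the fraction, so the later entries can be changed
    at will. *)
Lemma jfraction_beta2 be' : be 2 = 0 -> be' 2 = 0 -> be 1 = be' 1 ->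
  jfraction al be = jfraction al be'.
Proof.
move=> b2 b2' b1; apply/funext => n; rewrite /jfraction /jfraction_from.
case: n => [//|[|n]] /=; first by rewrite b1.
rewrite b1 b2 b2'; congr (fps_inv (jden _ _ (fps_inv _)) _).
by apply/funext => -[|[|k]] //=; rewrite !mul0r.
Qed.

Hypothesis be_ge0 : forall n, 0 <= be n.+1.

Lemma jfraction_sqrt : jfraction al be = jvec al (Num.sqrt \o be) ^~ 0%N.
Proof. by apply/funext => n; apply: jfraction_jvec => k; exact: sqr_sqrtr. Qed.

Lemma jfraction_has_moments :
  exists mu : probability (measurableTypeR R) R, has_moments mu (jfraction al be).
Proof. by rewrite jfraction_sqrt; exact: jvec_moments. Qed.

End JacobiParameters.

(** * Terminating fractions: one or two atoms *)

Section Degenerate.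
Context (R : realType).
Variables (a b : nat -> R).
Local Notation m := (jvec a b ^~ 0%N).
Local Notation L := (mfunct m).

(** Here [e_0] is an eigenvector of [J] with eigenvalue [a 0]. *)
Lemma one_atom : b 1 = 0 -> moment_determinate m /\
  forall mu, has_moments mu m -> formed_of_atoms 1 mu.
Proof.
move=> b1; pose P : {poly R} := 'X - (a 0%N)%:P.
have LP n : L ('X^n * P) = 0.
  rewrite /P mulrBr -exprSr mulrC mul_polyC linearB /= mfunctZ !mfunctXn.
  by rewrite jvecS b1 /=; ring.
have PPs x : root P x -> x \in [:: a 0%N] by rewrite root_XsubC inE.
have LPP := mfunct_mul_eq0 LP P.
split; first exact: finite_support_determinate LPP PPs.
move=> mu mum; have mus := annihilated_support mum LPP PPs.
exists [:: a 0%N]; split=> // x; rewrite inE => /eqP ->.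
by move: mus; rewrite measure_seq // big_seq1 => ->.
Qed.

(** The span of [e_0] and [e_1] is stable under [J]; [P] is the characteristic polynomial of this
    block, with eigenvalues [x] and [y]. *)
Lemma two_atoms : 0 < b 1 -> b 2 = 0 -> moment_determinate m /\
  forall mu, has_moments mu m -> formed_of_atoms 2 mu.
Proof.
move=> b1 b2; pose D := Num.sqrt ((a 0%N - a 1) ^+ 2 + 4 * b 1 ^+ 2).
have b12 : 0 < b 1 ^+ 2 by rewrite exprn_gt0.
have a2 := sqr_ge0 (a 0%N - a 1).
have D2 : D ^+ 2 = (a 0%N - a 1) ^+ 2 + 4 * b 1 ^+ 2 by rewrite sqr_sqrtr //; lra.
have D0 : 0 < D by rewrite sqrtr_gt0; lra.
pose x := (a 0%N + a 1 + D) / 2; pose y := (a 0%N + a 1 - D) / 2.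
pose P : {poly R} := ('X - x%:P) * ('X - y%:P).
have LP n : L ('X^n * P) = 0.
  have -> : 'X^n * P = 'X^(n.+2) - (x + y) *: 'X^(n.+1) + (x * y) *: 'X^n.
    by rewrite /P -!mul_polyC !(rmorphD, rmorphM) /= !exprS; ring.
  rewrite linearD linearB /= !mfunctZ !mfunctXn.
  have -> : x + y = a 0%N + a 1 by rewrite /x /y; lra.
  have -> : x * y = a 0%N * a 1 - b 1 ^+ 2.
    have -> : x * y = ((a 0%N + a 1) ^+ 2 - D ^+ 2) / 4 by rewrite /x /y; field.
    by rewrite D2; field.
  by rewrite [jvec _ _ n.+2 _]jvecS [jvec _ _ n.+1 1]jvecS [jvec _ _ n.+1 0]jvecS b2 /=; ring.
have PPs z : root P z -> z \in [:: x; y].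
  by rewrite rootM !root_XsubC !inE.
have LPP := mfunct_mul_eq0 LP P.
have xy : y < x by rewrite /x /y; lra.
have us : uniq [:: x; y] by rewrite /= inE gt_eqF.
split; first exact: finite_support_determinate us LPP PPs.
move=> mu mum; have mus := annihilated_support mum LPP PPs.
have m1 : jvec a b 1 0 = a 0%N by rewrite jvecS /=; ring.
(* [P(a_0) = - b_1^2 < 0] puts [a_0] strictly between the roots, which makes both weights
   positive. *)
have ay : y < a 0%N < x.
  have : (a 0%N - x) * (a 0%N - y) < 0.
    have -> : (a 0%N - x) * (a 0%N - y) = ((a 0%N - a 1) ^+ 2 - D ^+ 2) / 4.
      by rewrite /x /y; field.
    by rewrite D2; lra.
  by clearbody x y => xy0; apply/andP; split; rewrite ltNge; apply/negP => ?; nra.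
have wt (z w : R) : z \in [:: x; y] -> [:: x; y] =i [:: z; w] -> w != z ->
    mu [set z] = ((a 0%N - w) / (z - w))%:E.
  move=> zs sE wz; have zw : z - w != 0 by rewrite subr_eq0 eq_sym.
  rewrite (atom_weight (p := (z - w)^-1 *: ('X - w%:P)) mum mus zs).
  - rewrite mfunctZ linearB /= mfunctC (mfunctXn m 1) m1 /=.
    by congr EFin; rewrite mulr1 mulrC.
  - by rewrite !hornerE mulVf.
  - move=> t; rewrite sE !inE => /orP[/eqP ->|/eqP -> _]; first by rewrite eqxx.
    by rewrite !hornerE subrr mulr0.
exists [:: x; y]; split=> // z; have /andP[ay1 ax1] := ay.
have yx : y != x by rewrite lt_eqF.
rewrite !inE => /orP[] /eqP ->.
  by rewrite (wt x y) ?inE ?eqxx // lte_fin divr_gt0 // subr_gt0.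
rewrite (wt y x) ?inE ?eqxx ?orbT 1?eq_sym //; last first.
  by move=> t; rewrite !inE orbC.
by rewrite lte_fin -mulrNN -invrN !opprB divr_gt0 // subr_gt0.
Qed.

End Degenerate.

(** If the sums stayed below [A], the partial sums of the harmonic series would stay below
    [C * A]. *)
Lemma carleman_linear (R : realType) (b : nat -> R) C : 0 < C ->
  (forall k, 0 < b k.+1) -> (forall k, b k.+1 <= C * k.+1%:R) ->
  forall A : R, exists n, A <= \sum_(k < n) (b k.+1)^-1.
Proof.
move=> C0 b0 bC A; apply: contrapT => /forallNP nA; apply: (@dvg_harmonic R).
apply: nondecreasing_is_cvgn.
  by apply: nondecreasing_series => k _ _; rewrite harmonic_ge0.
exists (C * A) => _ [n _ <-]; rewrite /series /= big_mkord.
apply: (@le_trans _ _ (C * \sum_(k < n) (b k.+1)^-1)); last first.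
  by rewrite ler_pM2l // ltW // ltNge; apply/negP; exact: nA.
rewrite mulr_sumr; apply: ler_sum => k _; rewrite /harmonic /=.
by rewrite -[leLHS]mul1r ler_pdivrMr // mulrAC ler_pdivlMr // mul1r.
Qed.

Theorem corollary1 (R : realType) (a b c d f g h l p r s t u w : R)
    (m : nat -> R)
    (mE : m = jfraction (alpha a b f g s t u w) (beta c d h l p r))
    (pr_ge0 : 0 <= p * r)
    (hcdhl : c = - d \/ h = - l \/ (- d < c /\ - l < h) \/ (c < - d /\ h < - l)) :
  exists mu : probability (measurableTypeR R) R,
    [/\ has_moments mu m,
        p = 0 \/ r = 0 -> moment_determinate m /\ formed_of_atoms 1 mu,
        0 < p * r -> c = - d \/ h = - l ->
          moment_determinate m /\ formed_of_atoms 2 mu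
      & Num.max `|c| `|d| * Num.max `|h| `|l| <= 1 -> moment_determinate m].
Proof.
set al := alpha a b f g s t u w in mE; set be := beta c d h l p r in mE.
have be1 : be 1 = p * r by rewrite /be /beta !xybracket1 !mulr1.
have [pr0|pr_neq0] := eqVneq (p * r) 0.
  have be0 n : be n = 0 by rewrite /be /beta pr0 !mul0r.
  have be_ge0 n : 0 <= be n.+1 by rewrite be0.
  have [mu mum] := jfraction_has_moments al be_ge0.
  rewrite mE; exists mu; rewrite (jfraction_sqrt al be_ge0) in mum *.
  have [|det atoms] := @one_atom R al (Num.sqrt \o be); first by rewrite /= be0 sqrtr0.
  by split=> // [_|]; [split=> //; exact: atoms|rewrite pr0 ltxx].
have pr_gt0 : 0 < p * r by rewrite lt_neqAle eq_sym pr_neq0.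
have pr_ne : ~ (p = 0 \/ r = 0).
  by case=> z; move: pr_neq0; rewrite z ?mul0r ?mulr0 eqxx.
have [deg|nondeg] := pselect (c = - d \/ h = - l).
  have be2 : be 2 = 0.
    rewrite /be /beta !xybracket2; case: deg => ->; rewrite addNr ?mulr0 //.
    by rewrite mul0r.
  (* [be n] may be negative for [n >= 3], but [be 2 = 0] cuts the fraction. *)
  pose be' n := if n == 1%N then p * r else 0.
  have be'_ge0 n : 0 <= be' n.+1 by rewrite /be'; case: ifP.
  have -> : m = jfraction al be' by rewrite mE; apply: jfraction_beta2.
  have [mu mum] := jfraction_has_moments al be'_ge0.
  exists mu; rewrite (jfraction_sqrt al be'_ge0) in mum *.
  have [||det atoms] := @two_atoms R al (Num.sqrt \o be').
  - by rewrite sqrtr_gt0.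
  - by rewrite /= sqrtr0.
  by split=> // _ _; split=> //; exact: atoms.
have be_gt0 n : 0 < be n.+1.
  rewrite /be /beta -mulrA mulr_gt0 //.
  have [[cd hl]|[cd hl]] : (- d < c /\ - l < h) \/ (c < - d /\ h < - l).
  - by case: hcdhl => [cd|[hl|//]]; case: nondeg; [left|right].
  - by rewrite mulr_gt0 // xybracket_gt0.
  have <- : xybracket n.+1 (- c) (- d) * xybracket n.+1 (- h) (- l) =
      xybracket n.+1 c d * xybracket n.+1 h l.
    by rewrite !xybracketN mulrACA -expr2 sqrr_sign mul1r.
  by rewrite mulr_gt0 // xybracket_gt0 // opprK ltrNr.
have be_ge0 n : 0 <= be n.+1 by exact: ltW.
have [mu mum] := jfraction_has_moments al be_ge0.
rewrite mE; exists mu; rewrite (jfraction_sqrt al be_ge0) in mum *.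
split=> // MM1; apply: carleman_determinate => [k|]; first by rewrite sqrtr_gt0.
(* [be (k+1)] is at most [p r (k+1)^2] times the [k]-th power of the product of maxima, which is at
   most 1; the square root is then at most linear in [k+1]. *)
apply: (@carleman_linear _ _ (Num.sqrt (p * r))) => [|k|k] /=; rewrite ?sqrtr_gt0 //.
rewrite -[k.+1%:R]ger0_norm // -sqrtr_sqr -sqrtrM // ler_wsqrtr //.
rewrite /be /beta -mulrA ler_pM2l //; apply: le_trans (ler_norm _) _; rewrite normrM.
apply: le_trans (ler_pM _ _ (xybracket_le _ _ _) (xybracket_le _ _ _)) _ => //.
by rewrite mulrACA -exprMn -expr2 ler_piMr ?exprn_ile1.
Qed.
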